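(* For every integer $d\geq 4$, the number of LU-equivalence classes of 2-unitary matrices of size $d^2$ (equivalently, the number of LU-equivalence classes of AME$(4,d)$ states) is infinite.
   Context: For a matrix $U$ on $\mathbb{C}^d\otimes\mathbb{C}^d$ with entries $\langle i\alpha|U|j\beta\rangle$ in the computational product basis, its realignment $U^R$ is defined by $\langle ij|U^R|\alpha\beta\rangle=\langle i\alpha|U|j\beta\rangle$ and its partial transpose $U^\Gamma$ by $\langle i\beta|U^\Gamma|j\alpha\rangle=\langle i\alpha|U|j\beta\rangle$. $U$ is 2-unitary if $U$, $U^R$ and $U^\Gamma$ are all unitary. Two matrices $U,U'$ of size $d^2$ are LU-equivalent if $U'=(u_1\otimes u_2)U(v_1\otimes v_2)$ for some $d\times d$ unitaries $u_1,u_2,v_1,v_2$. An AME$(4,d)$ state is a pure state $|\psi\rangle\in(\mathbb{C}^d)^{\otimes 4}$ such that the reduced density matrix of every subset of at most two of the four parties is maximally mixed; two such states are LU-equivalent if one is obtained from the other by applying $w_1\otimes w_2\otimes w_3\otimes w_4$ with $w_k$ single-qudit unitaries. A unitary $U$ of size $d^2$ defines the state $|\Psi_U\rangle=\frac1d\sum_{i,\alpha,j,\beta}\langle i\alpha|U|j\beta\rangle\,|i\alpha j\beta\rangle$, which is AME$(4,d)$ when $U$ is 2-unitary. *)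

(* Defs.v *)
From HB Require Import structures.
From mathcomp Require Import all_boot all_order all_algebra.
From mathcomp Require Import complex.
From mathcomp Require Import reals.
Set Implicit Arguments. Unset Strict Implicit. Unset Printing Implicit Defensive.
Import Order.TTheory GRing.Theory Num.Theory.
Local Open Scope ring_scope.

Section Defs.
Variable R : realType.
Local Notation C := R[i].

Definition adj m n (A : 'M[C]_(m, n)) : 'M[C]_(n, m) := \matrix_(i, j) (A j i)^*.

Definition unitary n (A : 'M[C]_n) : Prop := A *m adj A = 1%:M.

(* product basis: |i alpha> of C^d (x) C^d  <->  index pidx i alpha of 'I_(d*d) *)
Definition pidx d (i a : 'I_d) : 'I_(d * d) := mxvec_index i a.
Definition punpair d (k : 'I_(d * d)) : 'I_d * 'I_d :=
  enum_val (cast_ord (esym (@mxvec_cast d d)) k).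

Definition kron d (u v : 'M[C]_d) : 'M[C]_(d * d) :=
  \matrix_(k, l) (u (punpair k).1 (punpair l).1 * v (punpair k).2 (punpair l).2).

Definition realign d (U : 'M[C]_(d * d)) : 'M[C]_(d * d) :=
  \matrix_(k, l) U (pidx (punpair k).1 (punpair l).1) (pidx (punpair k).2 (punpair l).2).

Definition ptrans d (U : 'M[C]_(d * d)) : 'M[C]_(d * d) :=
  \matrix_(k, l) U (pidx (punpair k).1 (punpair l).2) (pidx (punpair l).1 (punpair k).2).

Definition two_unitary d (U : 'M[C]_(d * d)) : Prop :=
  [/\ unitary U, unitary (realign U) & unitary (ptrans U)].

Definition LU_equiv d (U U' : 'M[C]_(d * d)) : Prop :=
  exists u1 u2 v1 v2 : 'M[C]_d,
    [/\ unitary u1, unitary u2, unitary v1, unitary v2 &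
        U' = kron u1 u2 *m U *m kron v1 v2].

End Defs.

(* Main.v *)
(* Contracting n copies of a tensor T on four legs with n copies of its complex
   conjugate, the l-th legs being matched along a permutation s_l, gives a number
   that only depends on the local unitary class of T.  It therefore suffices to
   find, for every d, a family of 2-unitaries on which one such invariant takes
   infinitely many values.

   For d <> 6 there is a pair of orthogonal Latin squares (L, M) of order d.  The
   permutation matrix pairing |i a> with |L i a, M i a> is 2-unitary, also when one
   cell receives a phase z.  As d^2 > 4d - 1, some nonzero integer function on the
   cells has zero sum on all the lines of the net; its positive and negative parts
   are two multisets of cells with the same four marginals, and matching them
   leg by leg gives permutations for which the invariant, a Laurent polynomial in
   z with natural coefficients, is not constant.

   For d = 6 let w be a primitive cube root of unity and x, y, z complex numbers of
   modulus 1 with x + y + z = 1 + 2w.  A Bell-diagonal tensor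
   T(i,a,j,b) = [i - a = j - b] h(i - a, a - b) over Z/6 = Z/2 x Z/3 is 2-unitary for
   h(k,l) = w^(l^2) V(k, l mod 2) / (2 sqrt 3), where the values of V over Z/3 are
   p + q, p - q, r + s, s - r times the phase (1, w, 1), with p = (x, y, z),
   q = (z, x, y), r = (1, 1, 1) and s = -(y, z, x).  On this curve the invariant of
   degree four given by the Klein four-group is a quadratic polynomial in Im(xyz),
   which is not constant. *)
Require Import Defs.
From Stdlib Require Import ZArith.
From HB Require Import structures.
From mathcomp Require Import all_boot all_order all_fingroup all_algebra.
From mathcomp Require Import cyclic complex reals ring lra zify ssrZ.
Set Implicit Arguments. Unset Strict Implicit. Unset Printing Implicit Defensive.
Import Order.TTheory GRing.Theory Num.Theory.
Local Open Scope ring_scope.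
Delimit Scope Z_scope with bz.

(** * Local unitary invariants of a four-leg tensor *)

Section Tensors.
Variables (R : realType) (d : nat).
Local Notation C := R[i].
Implicit Types (T : 'I_d -> 'I_d -> 'I_d -> 'I_d -> C) (U : 'M[C]_(d * d)).

Definition tensor U i a j b := U (pidx i a) (pidx j b).

Definition tensor_mx T : 'M[C]_(d * d) :=
  \matrix_(k, l) T (punpair k).1 (punpair k).2 (punpair l).1 (punpair l).2.

Lemma pidxK (i a : 'I_d) : punpair (pidx i a) = (i, a).
Proof. by rewrite /punpair /pidx /mxvec_index cast_ordK enum_rankK. Qed.

Lemma punpairK (k : 'I_(d * d)) : pidx (punpair k).1 (punpair k).2 = k.
Proof.
rewrite /punpair /pidx /mxvec_index -surjective_pairing enum_valK.
by rewrite cast_ordKV.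
Qed.

Lemma tensor_mxK T i a j b : tensor (tensor_mx T) i a j b = T i a j b.
Proof. by rewrite /tensor mxE !pidxK. Qed.

Lemma big_pidx (F : 'I_(d * d) -> C) :
  \sum_k F k = \sum_i \sum_a F (pidx i a).
Proof.
rewrite pair_big /= (reindex (fun p : 'I_d * 'I_d => pidx p.1 p.2)) //.
exists (@punpair d) => [[i a] _|k _]; first exact: pidxK.
exact: punpairK.
Qed.

Lemma pidx_eq (i a i' a' : 'I_d) :
  (pidx i a == pidx i' a') = (i == i') && (a == a').
Proof.
apply/eqP/andP => [/(congr1 (@punpair d))|[/eqP-> /eqP->] //].
by rewrite !pidxK => -[-> ->].
Qed.

(** Four legs can be cut into two pairs in three ways. The clauses are unitarity across these cuts,
    which belong to U, its realignment and its partial transpose in this order. *)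
Definition perfect T :=
  [/\ forall i a i' a', \sum_j \sum_b T i a j b * (T i' a' j b)^* =
        ((i == i') && (a == a'))%:R,
      forall i j i' j', \sum_a \sum_b T i a j b * (T i' a j' b)^* =
        ((i == i') && (j == j'))%:R &
      forall i b i' b', \sum_j \sum_a T i a j b * (T i' a j b')^* =
        ((i == i') && (b == b'))%:R].

Lemma unitaryP (A : 'M[C]_(d * d)) :
  (forall i a i' a', \sum_j \sum_b A (pidx i a) (pidx j b) *
     (A (pidx i' a') (pidx j b))^* = ((i == i') && (a == a'))%:R) ->
  unitary A.
Proof.
move=> uA; apply/matrixP => k k'; rewrite !mxE.
under eq_bigr do rewrite mxE.
rewrite big_pidx -(punpairK k) -(punpairK k') uA -pidx_eq.
by rewrite !punpairK.
Qed.

Lemma perfect_two_unitary T : perfect T -> two_unitary (tensor_mx T).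
Proof.
move=> [pT1 pT2 pT3]; split; apply: unitaryP => i a i' a'.
- rewrite -pT1; do 2!apply: eq_bigr => ? _; by rewrite !mxE !pidxK.
- rewrite -pT2; do 2!apply: eq_bigr => ? _; by rewrite !mxE !pidxK /= ?mxE ?pidxK.
- rewrite -pT3; do 2!apply: eq_bigr => ? _; by rewrite !mxE !pidxK /= ?mxE ?pidxK.
Qed.

Section Invariant.
Variable n : nat.
Implicit Types (s : 'S_n) (x : {ffun 'I_n -> 'I_d}).

Definition inv_term T s1 s2 s3 s4 x1 x2 x3 x4 : C :=
  \prod_k (T (x1 k) (x2 k) (x3 k) (x4 k) *
    (T (x1 (s1 k)) (x2 (s2 k)) (x3 (s3 k)) (x4 (s4 k)))^*).

Definition LUinv T s1 s2 s3 s4 : C :=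
  \sum_x1 \sum_x2 \sum_x3 \sum_x4 inv_term T s1 s2 s3 s4 x1 x2 x3 x4.

(** A cyclic shift of the legs, so that invariance only has to be proved for a unitary on the first
    leg. *)
Definition rotate_legs T i a j b := T b i a j.

Lemma inv_rot T s1 s2 s3 s4 : LUinv (rotate_legs T) s2 s3 s4 s1 = LUinv T s1 s2 s3 s4.
Proof.
rewrite /LUinv [RHS]exchange_big; apply: eq_bigr => x2 _.
rewrite [RHS]exchange_big; apply: eq_bigr => x3 _.
by rewrite [RHS]exchange_big; apply: eq_bigr => x4 _; apply: eq_bigr.
Qed.

Definition act1 (w : 'I_d -> 'I_d -> C) T i a j b := \sum_i' w i i' * T i' a j b.

Definition isometric (w : 'I_d -> 'I_d -> C) :=
  forall i' i'', \sum_i w i i' * (w i i'')^* = (i' == i'')%:R.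

Lemma isometric_dot w (f g : 'I_d -> C) : isometric w ->
  \sum_i (\sum_i' w i i' * f i') * (\sum_i' w i i' * g i')^* =
  \sum_i f i * (g i)^*.
Proof.
move=> ww; under eq_bigr do rewrite rmorph_sum mulr_suml.
rewrite exchange_big; apply: eq_bigr => j _ /=.
transitivity (\sum_k (\sum_i w i j * (w i k)^*) * (f j * (g k)^*)).
  under [RHS]eq_bigr do rewrite mulr_suml.
  rewrite [RHS]exchange_big; apply: eq_bigr => i _ /=.
  rewrite mulr_sumr; apply: eq_bigr => k _; rewrite rmorphM /=.
  by rewrite [RHS]mulrACA.
under eq_bigr do rewrite ww.
rewrite (bigD1 j) //= eqxx mul1r big1 ?addr0 // => k /negPf nkj.
by rewrite eq_sym nkj mul0r.
Qed.

(* With the other three legs fixed, the sum over the first one factors into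
   inner products of slices of the tensor. *)
Lemma inv_slices T s1 s2 s3 s4 : LUinv T s1 s2 s3 s4 =
  \sum_(x2 : {ffun 'I_n -> 'I_d}) \sum_(x3 : {ffun 'I_n -> 'I_d})
    \sum_(x4 : {ffun 'I_n -> 'I_d}) \prod_k \sum_i T i (x2 k) (x3 k) (x4 k) *
     (T i (x2 (s2 ((s1^-1)%g k))) (x3 (s3 ((s1^-1)%g k)))
          (x4 (s4 ((s1^-1)%g k))))^*.
Proof.
rewrite /LUinv exchange_big; apply: eq_bigr => x2 _ /=.
rewrite exchange_big; apply: eq_bigr => x3 _ /=.
rewrite exchange_big; apply: eq_bigr => x4 _ /=.
rewrite bigA_distr_bigA; apply: eq_bigr => x1 _.
rewrite /inv_term !big_split /=; congr (_ * _).
rewrite [RHS](reindex_inj (@perm_inj _ s1)); apply: eq_bigr => k _.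
by rewrite permK.
Qed.

Lemma inv_act1 w T s1 s2 s3 s4 : isometric w ->
  LUinv (act1 w T) s1 s2 s3 s4 = LUinv T s1 s2 s3 s4.
Proof.
move=> ww; rewrite !inv_slices; do 3!apply: eq_bigr => ? _.
by apply: eq_bigr => k _; rewrite isometric_dot.
Qed.

Lemma eq_inv T T' s1 s2 s3 s4 : (forall i a j b, T i a j b = T' i a j b) ->
  LUinv T s1 s2 s3 s4 = LUinv T' s1 s2 s3 s4.
Proof.
by move=> eqT; do 4!apply: eq_bigr => ? _; apply: eq_bigr => k _; rewrite !eqT.
Qed.

Lemma unitary_isometric (u : 'M[C]_d) : unitary u -> isometric u.
Proof.
move=> /mulmx1C uu i j; move/matrixP/(_ j i): uu; rewrite !mxE eq_sym => <-.
by apply: eq_bigr => k _; rewrite mxE mulrC.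
Qed.

Lemma unitary_trmx_isometric (u : 'M[C]_d) : unitary u -> isometric u^T.
Proof.
move=> uu i j; move/matrixP/(_ i j): uu; rewrite !mxE => <-.
by apply: eq_bigr => k _; rewrite !mxE.
Qed.

(** Each local unitary acts on one leg; [v1] and [v2] multiply on the right and so act through their
    transposes. Four rotations bring the legs back to their places. *)
Lemma tensor_kron_mul (u1 u2 v1 v2 : 'M[C]_d) U i a j b :
  tensor (kron u1 u2 *m U *m kron v1 v2) i a j b =
  act1 u1 (rotate_legs (act1 v2^T (rotate_legs (act1 v1^T (rotate_legs
    (act1 u2 (rotate_legs (tensor U)))))))) i a j b.
Proof.
rewrite /tensor -mulmxA mxE big_pidx.
apply: eq_bigr => i' _ /=.
under eq_bigr do rewrite mxE !pidxK /= -mulrA; rewrite -mulr_sumr.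
congr (_ * _); rewrite /rotate_legs /act1.
transitivity (\sum_a' \sum_j' \sum_b' u2 a a' * (v1 j' j * v2 b' b *
    U (pidx i' a') (pidx j' b'))).
  apply: eq_bigr => a' _; rewrite mxE big_pidx mulr_sumr.
  apply: eq_bigr => j' _; rewrite mulr_sumr; apply: eq_bigr => b' _.
  by rewrite !mxE !pidxK /= [_ * (v1 _ _ * _)]mulrC.
rewrite exchange_big [RHS](_ : _ = \sum_b' \sum_j' \sum_a' v2 b' b *
  (v1 j' j * (u2 a a' * U (pidx i' a') (pidx j' b')))); last first.
  apply: eq_bigr => b' _; rewrite mxE mulr_sumr; apply: eq_bigr => j' _.
  by rewrite mxE !mulr_sumr.
rewrite [RHS]exchange_big; apply: eq_bigr => j' _ /=.
rewrite exchange_big; apply: eq_bigr => b' _; apply: eq_bigr => a' _ /=.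
by rewrite [v1 _ _ * v2 _ _]mulrC -mulrA mulrCA; congr (_ * _); rewrite mulrCA.
Qed.

Lemma LU_inv U U' s1 s2 s3 s4 : LU_equiv U U' ->
  LUinv (tensor U') s1 s2 s3 s4 = LUinv (tensor U) s1 s2 s3 s4.
Proof.
move=> [u1 [u2 [v1 [v2 [Hu1 Hu2 Hv1 Hv2 ->]]]]].
rewrite (eq_inv _ _ _ _ (tensor_kron_mul u1 u2 v1 v2 U)).
rewrite inv_act1; last exact: unitary_isometric.
rewrite inv_rot inv_act1; last exact: unitary_trmx_isometric.
rewrite inv_rot inv_act1; last exact: unitary_trmx_isometric.
rewrite inv_rot inv_act1; last exact: unitary_isometric.
by rewrite inv_rot.
Qed.

End Invariant.
End Tensors.

Lemma family_of_inv (R : realType) (d n m : nat) (s1 s2 s3 s4 : 'S_m)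
    (T : 'I_n -> 'I_d -> 'I_d -> 'I_d -> 'I_d -> R[i]) :
  (forall k, perfect (T k)) ->
  injective (fun k => LUinv (T k) s1 s2 s3 s4) ->
  exists f : 'I_n -> 'M[R[i]]_(d * d),
    (forall k, two_unitary (f k)) /\
    (forall k l, k != l -> ~ LU_equiv (f k) (f l)).
Proof.
move=> pT injT; exists (fun k => tensor_mx (T k)); split.
  by move=> k; apply: perfect_two_unitary.
move=> k l /eqP nkl /(LU_inv s1 s2 s3 s4).
rewrite !(eq_inv _ _ _ _ (tensor_mxK _)) => /injT elk.
by apply: nkl.
Qed.

Definition o4 k (lt_k : (k < 4)%N) : 'I_4 := Ordinal lt_k.
Local Notation o k := (@o4 k isT).

Lemma forall4 (P : 'I_4 -> Prop) : P (o 0) -> P (o 1) -> P (o 2) -> P (o 3) ->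
  forall k, P k.
Proof.
by move=> P0 P1 P2 P3 [[|[|[|[|//]]]] lt_k]; rewrite (bool_irrelevance lt_k isT).
Qed.

(** * Bell-diagonal tensors in dimension six *)

Lemma sum_param (V : nmodType) (A B : finType) (phi : A -> B) (psi : B -> A)
    (F : B -> V) :
  cancel phi psi -> (forall b, phi (psi b) != b -> F b = 0) ->
  \sum_b F b = \sum_a F (phi a).
Proof.
move=> phiK F0; rewrite (bigID (fun b => phi (psi b) == b)) /=.
rewrite [X in _ + X]big1 // addr0 (reindex_onto phi psi) => [|b /eqP //].
by apply: eq_bigl => a; rewrite phiK !eqxx.
Qed.

Lemma sum_pair (V : nmodType) (A B : finType) (F : A * B -> V) :
  \sum_p F p = \sum_a \sum_b F (a, b).
Proof. by rewrite pair_bigA; apply: eq_bigr => -[]. Qed.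

Section Bell.
Variable R : realType.
Local Notation C := R[i].
Variable h : 'I_6 -> 'I_6 -> C.

Definition bell (i a j b : 'I_6) : C :=
  if j == b + (i - a) then h (i - a) (a - b) else 0.

(* Two of the four leg permutations agreeing somewhere would let 2-unitarity
   contract a pair of tensors, so the rows of a Latin square of order four, here
   the Klein four-group, are the first nontrivial case. *)
Definition row4 (r : seq 'I_4) (k : 'I_4) := nth k r k.

Definition kl_row1 := [:: o 1; o 0; o 3; o 2].
Definition kl_row2 := [:: o 2; o 3; o 0; o 1].
Definition kl_row3 := [:: o 3; o 2; o 1; o 0].

Lemma row4_inj r : r \in [:: kl_row1; kl_row2; kl_row3] -> injective (row4 r).
Proof.
by rewrite !inE => /or3P[] /eqP->;
  [apply: (@can_inj _ _ _ (row4 kl_row1)) | apply: (@can_inj _ _ _ (row4 kl_row2)) |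
   apply: (@can_inj _ _ _ (row4 kl_row3))]; apply: forall4.
Qed.

Definition kl1 : 'S_4 := perm (@row4_inj kl_row1 isT).
Definition kl2 : 'S_4 := perm (@row4_inj kl_row2 isT).
Definition kl3 : 'S_4 := perm (@row4_inj kl_row3 isT).

Lemma klE k : (kl1 k = row4 kl_row1 k) * (kl2 k = row4 kl_row2 k) *
  (kl3 k = row4 kl_row3 k).
Proof. by rewrite !permE. Qed.

Lemma big_ord4 (idx : C) (op : Monoid.law idx) (F : 'I_4 -> C) :
  \big[op/idx]_k F k = op (F (o 0)) (op (F (o 1)) (op (F (o 2)) (F (o 3)))).
Proof.
rewrite !big_ord_recl big_ord0 Monoid.mulm1.
by congr (op (F _) (op (F _) (op (F _) (F _)))); apply: val_inj.
Qed.

Definition f4 (x0 x1 x2 x3 : 'I_6) : {ffun 'I_4 -> 'I_6} :=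
  [ffun k : 'I_4 => nth 0 [:: x0; x1; x2; x3] k].

Lemma f4E x0 x1 x2 x3 : (f4 x0 x1 x2 x3 (o 0) = x0) * (f4 x0 x1 x2 x3 (o 1) = x1) *
  (f4 x0 x1 x2 x3 (o 2) = x2) * (f4 x0 x1 x2 x3 (o 3) = x3).
Proof. by do !split; rewrite ffunE. Qed.

Lemma f4P (f : {ffun 'I_4 -> 'I_6}) x0 x1 x2 x3 :
  x0 = f (o 0) -> x1 = f (o 1) -> x2 = f (o 2) -> x3 = f (o 3) ->
  f4 x0 x1 x2 x3 = f.
Proof.
by move=> -> -> -> ->; apply/ffunP; apply: forall4; rewrite ffunE.
Qed.

Definition Phi (g E D c : 'I_6) : C :=
  \sum_p \sum_s h p s * h (g - p) (s + D) * h (p - E) (c - s) *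
    h (g - p + E) (c - s - D).

Definition Psi (g E D c : 'I_6) : C :=
  \sum_q \sum_v h q (v + E) * h (g - q) v * h (q + D) (c - v - E) *
    h (g - q - D) (c - v).

Let six6 := ('I_6 * 'I_6)%type.

(* The supports j - b = i - a of the eight tensors leave nine free parameters in
   the contraction; [Phi] and [Psi] collect the four T and the four T^*. *)
Definition kparam (t : six6 * six6 * (six6 * six6) * 'I_6) :
    {ffun 'I_4 -> 'I_6} * {ffun 'I_4 -> 'I_6} * {ffun 'I_4 -> 'I_6} *
    {ffun 'I_4 -> 'I_6} :=
  let: (((g, E), (D, c)), ((p, s), (q, v)), a0) := t in
  let a1 := a0 + (p - q) in let a2 := a0 + (c - s - v) in
  let a3 := a0 + (p - q) + (c - s - v) - D - E in
  let p1 := g - p in let p2 := p - E in let p3 := g - p + E in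
  let s1 := s + D in let s2 := c - s in let s3 := c - s - D in
  (f4 (a0 + p) (a1 + p1) (a2 + p2) (a3 + p3), f4 a0 a1 a2 a3,
   f4 (a0 - s + p) (a1 - s1 + p1) (a2 - s2 + p2) (a3 - s3 + p3),
   f4 (a0 - s) (a1 - s1) (a2 - s2) (a3 - s3)).

Definition kunparam (t : {ffun 'I_4 -> 'I_6} * {ffun 'I_4 -> 'I_6} *
    {ffun 'I_4 -> 'I_6} * {ffun 'I_4 -> 'I_6}) :
    six6 * six6 * (six6 * six6) * 'I_6 :=
  let: (i, a, j, b) := t in
  let p := i (o 0) - a (o 0) in let s := a (o 0) - b (o 0) in
  (((p + (i (o 1) - a (o 1)), p - (i (o 2) - a (o 2))),
    (a (o 1) - b (o 1) - s, s + (a (o 2) - b (o 2)))),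
   ((p, s), (i (o 0) - a (o 1), a (o 0) - b (o 2))), a (o 0)).

Lemma kparamK : cancel kparam kunparam.
Proof.
move=> [[[[g E] [D c]] [[p s] [q v]]] a0] /=; rewrite !f4E.
apply/eqP; rewrite !xpair_eqE -!andbA; do ?[apply/andP; split].
all: by apply/eqP; ring.
Qed.

Lemma bell_neq0 i a j b : bell i a j b != 0 -> j = b + (i - a).
Proof. by rewrite /bell; case: (j =P _) => // _; rewrite eqxx. Qed.

(** The factor 6 counts the common translation [a0], on which no entry of [h] depends. *)
Lemma inv_bell :
  LUinv bell 1%g kl1 kl2 kl3 =
  6%:R * \sum_g \sum_E \sum_D \sum_c Phi g E D c * (Psi g E D c)^*.
Proof.
transitivity (\sum_t inv_term bell 1%g kl1 kl2 kl3 t.1.1.1 t.1.1.2 t.1.2 t.2).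
  by rewrite /LUinv !pair_bigA.
rewrite (sum_param kparamK) => [|[[[i a] j] b]]; last first.
  apply: contraNeq => /= /prodf_neq0 F0.
  have T0 k : j k = b k + (i k - a k).
    by have := F0 k isT; rewrite mulf_eq0 negb_or => /andP[/bell_neq0].
  (* The relations [T0] and the relations [T1] have the same sum over k, so seven of the eight are
     independent: nine of the sixteen indices remain free. *)
  have T1 k : j (kl2 k) = b (kl3 k) + (i k - a (kl1 k)).
    have := F0 k isT; rewrite mulf_eq0 negb_or perm1 => /andP[_].
    by rewrite fmorph_eq0 => /bell_neq0.
  have := (T1 (o 0), T1 (o 1), T1 (o 2), T1 (o 3)); rewrite !klE /row4 /= !T0.
  move=> [[[E0 E1] E2] E3].
  have {}E0 : i (o 2) = a (o 2) - b (o 2) + (b (o 3) + (i (o 0) - a (o 1))).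
    by rewrite -E0; ring.
  have {}E1 : i (o 3) = a (o 3) - b (o 3) + (b (o 2) + (i (o 1) - a (o 0))).
    by rewrite -E1; ring.
  have {}E2 : a (o 3) = b (o 1) + i (o 2) - (b (o 0) + (i (o 0) - a (o 0))).
    by rewrite E2; ring.
  rewrite /kparam /kunparam /= !xpair_eqE -!andbA.
  by apply/and4P; split; apply/eqP; apply: f4P;
    rewrite ?T0 ?E1 ?E2 ?E0; ring.
pose Ph g E D c p s : C := h p s * h (g - p) (s + D) * h (p - E) (c - s) *
  h (g - p + E) (c - s - D).
pose Ps g E D c q v : C := h q (v + E) * h (g - q) v * h (q + D) (c - v - E) *
  h (g - q - D) (c - v).
pose G (t : six6 * six6 * (six6 * six6)) : C :=
  let: (((g, E), (D, c)), ((p, s), (q, v))) := t in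
  Ph g E D c p s * (Ps g E D c q v)^*.
rewrite (eq_bigr (fun t => G t.1)) => [|[[[[g E] [D c]] [[p s] [q v]]] a0] _].
  rewrite sum_pair; under eq_bigr do rewrite sumr_const card_ord -mulr_natl.
  rewrite -mulr_sumr !sum_pair; congr (_ * _).
  apply: eq_bigr => g _; apply: eq_bigr => E _.
  rewrite sum_pair; apply: eq_bigr => D _; apply: eq_bigr => c _.
  rewrite !sum_pair /Phi mulr_suml; apply: eq_bigr => p _.
  rewrite mulr_suml; apply: eq_bigr => s _.
  rewrite rmorph_sum mulr_sumr sum_pair.
  by apply: eq_bigr => q _; rewrite rmorph_sum mulr_sumr; apply: eq_bigr.
rewrite /inv_term big_ord4 !perm1 !klE /row4 /= !f4E /bell.
do ![rewrite ifT; last by apply/eqP; ring].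
rewrite /G /Ph /Ps !rmorphM /=.
transitivity (h p s * (h q (v + E))^* * (h (g - p) (s + D) * (h (g - q) v)^* *
  (h (p - E) (c - s) * (h (q + D) (c - v - E))^* *
  (h (g - p + E) (c - s - D) * (h (g - q - D) (c - v))^*)))); last by ring.
by congr (h _ _ * (h _ _)^* * (h _ _ * (h _ _)^* * (h _ _ * (h _ _)^* *
  (h _ _ * (h _ _)^*)))); ring.
Qed.

Lemma sum_if2 (x y : 'I_6) (f g : 'I_6 -> C) :
  \sum_j (if j == x then f j else 0) * (if j == y then g j else 0)^* =
  if x == y then f x * (g x)^* else 0.
Proof.
rewrite (bigD1 x) //= eqxx big1 ?addr0 => [|j /negPf->]; last by rewrite mul0r.
by case: eqP => // _; rewrite conjC0 mulr0.
Qed.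

(** The support is invariant under translation, so each cut splits into blocks indexed by one
    difference or sum of legs. What remains are correlations of the rows, columns and antidiagonals
    of [h] with their translates by (0,t), (t,0) and (t,t). *)
Lemma perfect_bell :
  (forall p t, \sum_s h p s * (h p (s + t))^* = (t == 0)%:R) ->
  (forall s t, \sum_p h p s * (h (p + t) s)^* = (t == 0)%:R) ->
  (forall k t, \sum_a h (k - a) a * (h (k + t - a) (a + t))^* = (t == 0)%:R) ->
  perfect bell.
Proof.
move=> h1 h2 h3; split=> [i a i' a'|i j i' j'|i b i' b'].
- rewrite exchange_big; under eq_bigr do rewrite sum_if2 (can_eq (addKr _)).
  case: (i - a =P i' - a') => [e|ne]; last first.
    rewrite big1 //; case: eqP => // ei; case: eqP => // ea.
    by case: ne; rewrite ei ea.
  rewrite -e (reindex_inj (inv_inj (subKr a))) /=.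
  transitivity (\sum_s h (i - a) s * (h (i - a) (s + (a' - a)))^*).
    by apply: eq_bigr => s _; congr (h _ _ * (h _ _)^*); ring.
  rewrite h1 subr_eq0 eq_sym; congr (_%:R); case: eqP => [ea|]; rewrite ?andbF //.
  rewrite andbT; suff -> : i = i' by rewrite eqxx.
  by apply: (addIr (- a)); rewrite {2}ea.
- under eq_bigr => a _.
    rewrite (eq_bigr (fun b => (if b == j - (i - a) then h (i - a) (a - b) else 0) *
      (if b == j' - (i' - a) then h (i' - a) (a - b) else 0)^*)); last first.
      by move=> b _; rewrite !(eq_sym b) !subr_eq.
    rewrite sum_if2 (_ : (_ == _) = (j - i == j' - i')); last first.
      by rewrite !opprB !addrA !(addrAC _ a) (can_eq (addrK _)).
    over.
  case: (j - i =P j' - i') => [e|ne]; last first.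
    rewrite big1 //; case: eqP => // ei; case: eqP => // ej.
    by case: ne; rewrite ei ej.
  rewrite (reindex_inj (inv_inj (subKr i))) /=.
  transitivity (\sum_p h p (i - j) * (h (p + (i' - i)) (i - j))^*).
    by apply: eq_bigr => p _; congr (h _ _ * (h _ _)^*); ring.
  rewrite h2 subr_eq0 eq_sym; congr (_%:R); case: eqP => // ei.
  suff -> : j = j' by rewrite eqxx.
  by apply: (addIr (- i)); rewrite e ei.
- rewrite exchange_big; under eq_bigr do
    (rewrite sum_if2 !addrA (can_eq (addrK _))).
  case: (b + i =P b' + i') => [e|ne]; last first.
    rewrite big1 //; case: eqP => // ei; case: eqP => // eb.
    by case: ne; rewrite ei eb.
  have ei : i' = i + b - b' by rewrite [i + b]addrC e; ring.
  rewrite (reindex_inj (addrI b)) /=.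
  transitivity (\sum_a h (i - b - a) a * (h (i - b + (b - b') - a) (a + (b - b')))^*).
    by apply: eq_bigr => a _; rewrite ei; congr (h _ _ * (h _ _)^*); ring.
  rewrite h3 subr_eq0; congr (_%:R); case: (b =P b') => [eb|]; rewrite ?andbF //.
  rewrite andbT; suff -> : i' = i by rewrite eqxx.
  by rewrite ei eb; ring.
Qed.
End Bell.

(** * Exact arithmetic on the curve x + y + z = 1 + 2w *)

(* Polynomials as coefficient lists in Horner form.  The multiplication is
   parametrised by the multiplication [mulX] by the indeterminate, so that the
   same code computes in quotient rings. *)
Section Horner.
Variables (K : Type) (add mul : K -> K -> K) (mulX : seq K -> seq K).

Fixpoint padd (p q : seq K) : seq K :=
  match p, q with
  | a :: p', b :: q' => add a b :: padd p' q'
  | [::], _ => q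
  | _, [::] => p
  end.

Fixpoint pmul (p q : seq K) : seq K :=
  if p is a :: p' then padd (map (mul a) q) (mulX (pmul p' q)) else [::].

Variables (C : comNzRingType) (ev : K -> C) (t : C).

Fixpoint pev (p : seq K) : C := if p is a :: p' then ev a + t * pev p' else 0.

Hypothesis ev_add : forall a b, ev (add a b) = ev a + ev b.
Hypothesis ev_mul : forall a b, ev (mul a b) = ev a * ev b.
Hypothesis ev_mulX : forall p, pev (mulX p) = t * pev p.

Lemma pev_add p q : pev (padd p q) = pev p + pev q.
Proof.
elim: p q => [|a p IHp] [|b q] //=; rewrite ?add0r ?addr0 //.
by rewrite ev_add IHp; ring.
Qed.

Lemma pev_scale a q : pev (map (mul a) q) = ev a * pev q.
Proof. by elim: q => [|b q IHq] /=; rewrite ?mulr0 // ev_mul IHq; ring. Qed.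

Lemma pev_mul p q : pev (pmul p q) = pev p * pev q.
Proof.
elim: p => [|a p IHp] /=; first by rewrite mul0r.
by rewrite pev_add pev_scale ev_mulX IHp; ring.
Qed.

End Horner.

(* The pair (a, b) stands for a + b w, with w a primitive cube root of unity. *)
Definition eis := (Z * Z)%type.
Definition eadd (a b : eis) : eis := (a.1 + b.1, a.2 + b.2)%bz.
Definition emul (a b : eis) : eis :=
  (a.1 * b.1 - a.2 * b.2, a.1 * b.2 + a.2 * b.1 - a.2 * b.2)%bz.

(* The coordinate ring over Z[w] of the curve x + y + z = th,
   xy + yz + zx = - th * xyz, where th = 1 + 2w: it is generated by e = xyz, x
   and y, with x a root of X^3 - th X^2 - th e X - e and y a root of
   Y^2 - (th - x) Y - (th e + th x - x^2). *)
Definition kring := seq eis.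
Definition kadd : kring -> kring -> kring := padd eadd.
Definition kmul : kring -> kring -> kring :=
  pmul eadd emul (fun p => if p is [::] then [::] else (0, 0)%bz :: p).

Definition th : eis := (1, 2)%bz.

Definition xring := seq kring.
Definition xadd : xring -> xring -> xring := padd kadd.
(** Shorter lists are only shifted; the cubic equation of x is applied at length three, so that
    products of reduced lists stay reduced. *)
Definition mulx (p : xring) : xring :=
  match p with
  | [:: c0; c1; c2] =>
      [:: kmul [:: (0, 0)%bz; (1, 0)%bz] c2;
          kadd c0 (kmul [:: (0, 0)%bz; th] c2); kadd c1 (kmul [:: th] c2)]
  | [::] => [::]
  | _ => [::] :: p
  end.
Definition xmul : xring -> xring -> xring := pmul kadd kmul mulx.

Definition aring := seq xring.
Definition aadd : aring -> aring -> aring := padd xadd.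
Definition muly (p : aring) : aring :=
  match p with
  | [:: d0; d1] =>
      [:: xmul [:: [:: (0, 0)%bz; th]; [:: th]; [:: (-1, 0)%bz]] d1;
          xadd d0 (xmul [:: [:: th]; [:: (-1, 0)%bz]] d1)]
  | [::] => [::]
  | _ => [::] :: p
  end.
Definition amul : aring -> aring -> aring := pmul xadd xmul muly.

Definition acst (c : eis) : aring := [:: [:: [:: c]]].
Definition ax : aring := [:: [:: [::]; [:: (1, 0)%bz]]].
Definition ay : aring := [:: [::]; [:: [:: (1, 0)%bz]]].
Definition ae : aring := [:: [:: [:: (0, 0)%bz; (1, 0)%bz]]].
Definition aopp : aring -> aring := amul (acst (-1, 0)%bz).
Definition az : aring := aadd (acst th) (aopp (aadd ax ay)).

Definition azero (p : aring) : bool :=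
  all (all (all (fun c : eis => Z.eqb c.1 0 && Z.eqb c.2 0))) p.

Definition asum (n : nat) (f : nat -> aring) : aring :=
  foldr (fun k => aadd (f k)) [::] (iota 0 n).

Arguments kadd : simpl never.
Arguments kmul : simpl never.
Arguments xadd : simpl never.
Arguments xmul : simpl never.

Section Eval.
Variables (C : comNzRingType) (w e x y : C).
Let thC : C := 1 + w *+ 2.
Hypothesis w3 : w ^+ 2 + w + 1 = 0.
Hypothesis x3 : x ^+ 3 = thC * x ^+ 2 + thC * e * x + e.
Hypothesis y2 : y ^+ 2 = (thC - x) * y + (thC * e + thC * x - x ^+ 2).

Definition zev (n : Z) : C := (int_of_Z n)%:~R.
Definition eev (a : eis) : C := zev a.1 + zev a.2 * w.
Definition kev := pev eev e.
Definition xev := pev kev x.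
Definition aev := pev xev y.

Lemma zev_add m n : zev (m + n)%bz = zev m + zev n.
Proof. by rewrite /zev -intrD -rmorphD. Qed.

Lemma zev_opp n : zev (- n)%bz = - zev n.
Proof. by rewrite /zev -intrN -rmorphN. Qed.

Lemma zev_mul m n : zev (m * n)%bz = zev m * zev n.
Proof. by rewrite /zev -intrM -rmorphM. Qed.

Lemma eev_add a b : eev (eadd a b) = eev a + eev b.
Proof. by rewrite /eev /= !zev_add; ring. Qed.

Lemma eev_mul a b : eev (emul a b) = eev a * eev b.
Proof.
rewrite /eev /= -!Z.add_opp_r !(zev_add, zev_mul, zev_opp).
have w2 : w ^+ 2 = - w - 1 by apply/eqP; rewrite -subr_eq0 -w3; apply/eqP; ring.
by ring: w2.
Qed.

Lemma eev_th : eev th = thC.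
Proof.
by rewrite /eev (_ : zev th.1 = 1) // (_ : zev th.2 = 2%:R) // mulr_natl.
Qed.

Lemma eev0 : eev (0, 0)%bz = 0.
Proof. by rewrite /eev /zev /= mul0r addr0. Qed.

Lemma eev1 : eev (1, 0)%bz = 1.
Proof. by rewrite /eev /zev /= mul0r addr0. Qed.

Lemma eevN1 : eev (-1, 0)%bz = -1.
Proof. by rewrite /eev /zev /= mul0r addr0. Qed.

Lemma kev_mul p q : kev (kmul p q) = kev p * kev q.
Proof.
apply: pev_mul => [||[|a r]]; [exact: eev_add | exact: eev_mul | |].
  by rewrite mulr0.
by rewrite /= -/(eev (0, 0)%bz) eev0 add0r.
Qed.

Lemma kev_add p q : kev (kadd p q) = kev p + kev q.
Proof. exact: pev_add eev_add _ _. Qed.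

Lemma xev_add p q : xev (xadd p q) = xev p + xev q.
Proof. exact: pev_add kev_add _ _. Qed.

Lemma xev_mulx p : xev (mulx p) = x * xev p.
Proof.
have kev0 : kev [::] = 0 by [].
case: p => [|c0 [|c1 [|c2 [|c3 p]]]]; rewrite /xev [mulx _]/= ![pev kev _ _]/=.
- by rewrite mulr0.
- by rewrite ?kev0 add0r.
- by rewrite ?kev0 add0r.
- rewrite !(kev_add, kev_mul) /kev /= eev_th ?eev0 ?eev1 ?eevN1.
  by ring: x3.
- by rewrite ?kev0 add0r.
Qed.

Lemma xev_mul p q : xev (xmul p q) = xev p * xev q.
Proof. exact: pev_mul kev_add kev_mul xev_mulx _ _. Qed.

Lemma aev_add p q : aev (aadd p q) = aev p + aev q.
Proof. exact: pev_add xev_add _ _. Qed.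

Lemma aev_muly p : aev (muly p) = y * aev p.
Proof.
have xev0 : xev [::] = 0 by [].
case: p => [|d0 [|d1 [|d2 p]]]; rewrite /aev [muly _]/= ![pev xev _ _]/=.
- by rewrite mulr0.
- by rewrite ?xev0 add0r.
- rewrite !(xev_add, xev_mul) /xev /= /kev /= !eev_th ?eev0 ?eev1 ?eevN1.
  by ring: y2.
- by rewrite ?xev0 add0r.
Qed.

Lemma aev_mul p q : aev (amul p q) = aev p * aev q.
Proof. exact: pev_mul xev_add xev_mul aev_muly _ _. Qed.

Lemma aev_cst c : aev (acst c) = eev c.
Proof. by rewrite /aev /xev /kev /=; ring. Qed.

Lemma aev_x : aev ax = x.
Proof. by rewrite /aev /xev /kev /= ?eev0 ?eev1; ring. Qed.

Lemma aev_y : aev ay = y.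
Proof. by rewrite /aev /xev /kev /= ?eev0 ?eev1; ring. Qed.

Lemma aev_e : aev ae = e.
Proof. by rewrite /aev /xev /kev /= ?eev0 ?eev1; ring. Qed.

Lemma aev_opp p : aev (aopp p) = - aev p.
Proof. by rewrite aev_mul aev_cst eevN1; ring. Qed.

Lemma aev_z : aev az = thC - x - y.
Proof. by rewrite aev_add aev_opp aev_add aev_cst aev_x aev_y eev_th; ring. Qed.

Lemma eev_zero c : Z.eqb c.1 0 && Z.eqb c.2 0 -> eev c = 0.
Proof.
by case: c => a b /andP[/Z.eqb_eq /= -> /Z.eqb_eq /= ->]; rewrite /eev /zev mul0r addr0.
Qed.

Lemma pev_zero (K : Type) (ev : K -> C) t (z : pred K) p :
  (forall a, z a -> ev a = 0) -> all z p -> pev ev t p = 0.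
Proof.
by move=> ez; elim: p => //= a p IHp /andP[/ez -> /IHp ->]; rewrite mulr0 addr0.
Qed.

Lemma aev_zero p : azero p -> aev p = 0.
Proof.
by apply: pev_zero => q; apply: pev_zero => r; apply: pev_zero => c /eev_zero.
Qed.

Lemma aev_eq p q : azero (aadd p (aopp q)) -> aev p = aev q.
Proof.
by move/aev_zero; rewrite aev_add aev_opp => /eqP; rewrite subr_eq0 => /eqP.
Qed.

Lemma aev_sum n f : aev (asum n f) = \sum_(k < n) aev (f k).
Proof.
rewrite -(big_mkord predT (fun k => aev (f k))) /asum /index_iota subn0.
by elim: (iota 0 n) => [|k r IHr] /=; rewrite ?big_nil // big_cons aev_add IHr.
Qed.

End Eval.

(** * The array h over the coordinate ring and its tabulated contractions *)

Definition eis_exp (k : nat) : eis :=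
  nth (0, 0)%bz [:: (1, 0); (0, 1); (-1, -1)]%bz (k %% 3).

Definition a1 : aring := acst (1, 0)%bz.
Definition avec (l : seq aring) (k : nat) : aring := nth [::] l (k %% 3).

Definition entry (p q r s : nat -> aring) (k : nat) (b : bool) : aring :=
  match odd k, b with
  | false, false => aadd (p k) (q k)
  | false, true => aadd (p k) (aopp (q k))
  | true, false => aadd (r k) (s k)
  | true, true => aadd (s k) (aopp (r k))
  end.

Definition vc0 (k : nat) (b : bool) : aring :=
  amul (acst (eis_exp (k %% 3 == 1)%N))
    (entry (avec [:: ax; ay; az]) (avec [:: az; ax; ay]) (avec [:: a1; a1; a1])
       (avec [:: aopp ay; aopp az; aopp ax]) k b).

(* [e] times the complex conjugate of [vc0], using e * x^* = yz, etc. *)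
Definition vb0 (k : nat) (b : bool) : aring :=
  let X := amul ay az in let Y := amul ax az in let Z := amul ax ay in
  amul (acst (eis_exp (2 * (k %% 3 == 1))%N))
    (entry (avec [:: X; Y; Z]) (avec [:: Z; X; Y]) (avec [:: ae; ae; ae])
       (avec [:: aopp Y; aopp Z; aopp X]) k b).

Definition mkbool (T : Type) (f : bool -> T) : T * T := (f false, f true).
Definition getbool (T : Type) (t : T * T) (b : bool) : T := if b then t.2 else t.1.

Definition vtable (f : nat -> bool -> aring) : seq (aring * aring) :=
  mkseq (fun k => mkbool (f k)) 6.
Definition vlookup (t : seq (aring * aring)) (k : nat) (b : bool) : aring :=
  getbool (nth ([::], [::]) t (k %% 6)) b.

Definition vc_table := Eval vm_compute in vtable vc0.
Definition vb_table := Eval vm_compute in vtable vb0.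
Definition vc := vlookup vc_table.
Definition vb := vlookup vb_table.

Definition sq3 (l : nat) : nat := ((l %% 3) ^ 2)%N.

(* [hc] is 2 sqrt 3 times the array h, and [hb] is e times its complex conjugate,
   whence the factor 12 e in [delta12]. *)
Definition hc (k l : nat) : aring := amul (acst (eis_exp (sq3 l))) (vc k (odd l)).
Definition hb (k l : nat) : aring :=
  amul (acst (eis_exp (2 * sq3 l)%N)) (vb k (odd l)).

Definition delta12 (t : nat) : aring :=
  if t is 0 then amul (acst (12, 0)%bz) ae else [::].
Definition aeq (p q : aring) : bool := azero (aadd p (aopp q)).

(** The three checks are the hypotheses of [perfect_bell] for [h], multiplied by 12 e to clear
    denominators. The term [6 - a] stands for -a modulo 6 without truncated subtraction. *)
Definition check1 : bool :=
  all (fun p => all (fun t =>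
    aeq (asum 6 (fun s => amul (hc p s) (hb p (s + t)%N))) (delta12 t))
    (iota 0 6)) (iota 0 6).
Definition check2 : bool :=
  all (fun s => all (fun t =>
    aeq (asum 6 (fun p => amul (hc p s) (hb (p + t)%N s))) (delta12 t))
    (iota 0 6)) (iota 0 6).
Definition check3 : bool :=
  all (fun k => all (fun t =>
    aeq (asum 6 (fun a => amul (hc (k + (6 - a))%N a) (hb (k + t + (6 - a))%N (a + t)%N)))
      (delta12 t)) (iota 0 6)) (iota 0 6).

(* The second index of h only enters through a phase and its parity, so the inner
   sum of [Phi] is a combination of two products, tabulated here, with Gauss sums
   [zsum] as coefficients. *)
Definition pair_table (V : nat -> bool -> aring) :=
  mkseq (fun k => mkseq (fun l => mkbool (fun b => mkbool (fun b' =>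
    amul (V k b) (V l b')))) 6) 6.

Definition pair_lookup t (k l : nat) (b b' : bool) : aring :=
  getbool (getbool (nth (([::], [::]), ([::], [::])) (nth [::] t (k %% 6)) (l %% 6)) b) b'.

Definition aW (B : nat -> nat -> bool -> bool -> aring) (g E : nat) (D c b : bool)
    (p : nat) : aring :=
  amul (B p (g + (6 - p))%N b (b (+) D))
       (B (p + (6 - E))%N (g + (6 - p) + E)%N (c (+) b) (c (+) b (+) D)).

Definition W_table B :=
  mkseq (fun g => mkseq (fun E => mkbool (fun D => mkbool (fun c => mkbool (fun b =>
    asum 6 (aW B g E D c b))))) 6) 6.
Definition W_lookup t (g E : nat) (D c b : bool) : aring :=
  let z := ([::], [::]) in
  getbool (getbool (getbool (nth ((z, z), (z, z)) (nth [::] t g) E) D) c) b.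

Definition zsum (z : nat) (D c : nat) (b : bool) : eis :=
  let term s := eis_exp (z * (sq3 s + sq3 (s + D) + sq3 (c + (6 - s)) +
    sq3 (c + (6 - s) + (6 - D))))%N in
  eadd (term b) (eadd (term (b + 2)%N) (term (b + 4)%N)).

(** The exponent [z] is 1 for [h] and 2 for its conjugate, because the conjugate of w is its
    square. *)
Definition aPhi (W : nat -> nat -> bool -> bool -> bool -> aring)
    (z g E D c : nat) : aring :=
  aadd (amul (acst (zsum z D c false)) (W g E (odd D) (odd c) false))
       (amul (acst (zsum z D c true)) (W g E (odd D) (odd c) true)).

Definition mkW (V : nat -> bool -> aring) := W_table (pair_lookup (pair_table V)).

Definition neg6 (k : nat) : nat := ((6 - k) %% 6)%N.

Definition aKlein : aring :=
  let Wc := W_lookup (mkW vc) in let Wb := W_lookup (mkW vb) in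
  asum 6 (fun g => asum 6 (fun E => asum 6 (fun D => asum 6 (fun c =>
    amul (aPhi Wc 1 g E D c) (aPhi Wb 2 g (neg6 D) (neg6 E) c))))).

(** The invariant times [e ^+ 4 * kappa ^+ 8 / 6]: in normal form it involves x and y only through
    e. *)
Definition klein_value : aring := [:: [:: [:: (0, 0); (0, 0); (466560, 0);
  (248832, 497664); (1804032, 0); (-248832, -497664); (466560, 0)]]]%bz.

Lemma check_unitarity : check1 && check2 && check3.
Proof. by vm_compute. Qed.

Lemma check_klein : aeq aKlein klein_value.
Proof. by vm_compute. Qed.

Arguments aadd : simpl never.
Arguments amul : simpl never.
Arguments aopp : simpl never.

Lemma vlookup_table f k b : vlookup (vtable f) k b = f (k %% 6)%N b.
Proof. by rewrite /vlookup nth_mkseq ?ltn_pmod //; case: b. Qed.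

Lemma pair_lookup_table V k l b b' : (forall k b, V (k %% 6)%N b = V k b) ->
  pair_lookup (pair_table V) k l b b' = amul (V k b) (V l b').
Proof.
move=> Vmod; rewrite /pair_lookup !nth_mkseq ?ltn_pmod //.
by rewrite -(Vmod k) -(Vmod l); case: b b' => -[].
Qed.

Lemma W_lookup_table B g E D c b : (g < 6)%N -> (E < 6)%N ->
  W_lookup (W_table B) g E D c b = asum 6 (aW B g E D c b).
Proof. by move=> g6 E6; rewrite /W_lookup !nth_mkseq //; case: D c b => [] [] []. Qed.

(** Shift the second summation index by E. One routine thereby evaluates both factors of the
    contraction. *)
Lemma Psi_Phi (R : realType) (h : 'I_6 -> 'I_6 -> R[i]) g E D c :
  Psi h g E D c = Phi h g (- D) (- E) c.
Proof.
rewrite /Psi /Phi; apply: eq_bigr => q _.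
rewrite [RHS](reindex_inj (addIr E)); apply: eq_bigr => v _ /=.
by congr (h _ _ * h _ _ * h _ _ * h _ _); ring.
Qed.

(** * Perfect tensors from points of the curve, and their Klein invariant *)

Section Curve.
Variables (R : realType).
Local Notation C := R[i].
Variables (w x y z kappa : C).
Let e := x * y * z.
Hypothesis w3 : w ^+ 2 + w + 1 = 0.
Hypothesis wJ : w^* = w ^+ 2.
Hypothesis sum_xyz : x + y + z = 1 + w *+ 2.
Hypotheses (xJ : x * x^* = 1) (yJ : y * y^* = 1) (zJ : z * z^* = 1).
Hypotheses (kappa2 : kappa ^+ 2 = 12%:R) (kappaJ : kappa^* = kappa).

Let exJ : e * x^* = y * z.
Proof. by rewrite /e; ring: xJ. Qed.
Let eyJ : e * y^* = x * z.
Proof. by rewrite /e; ring: yJ. Qed.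
Let ezJ : e * z^* = x * y.
Proof. by rewrite /e; ring: zJ. Qed.

(** Conjugate x + y + z = 1 + 2w and multiply by e: as x, y, z have modulus 1, the left side becomes
    the second symmetric function, while 1 + 2w is purely imaginary. *)
Lemma elem2 : x * y + y * z + z * x = - (1 + w *+ 2) * e.
Proof.
have : e * (x + y + z)^* = e * (1 + w *+ 2)^* by rewrite sum_xyz.
rewrite mulr2n !rmorphD /= wJ rmorph1 !mulrDr exJ eyJ ezJ => E.
have {}E : x * y + y * z + z * x = e * (1 + w ^+ 2 *+ 2).
  by rewrite mulr2n !mulrDr -E; ring.
have w2 : w ^+ 2 = - w - 1 by apply/eqP; rewrite -subr_eq0 -w3; apply/eqP; ring.
by rewrite E w2; ring.
Qed.

Let zE : z = (1 + w *+ 2) - x - y.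
Proof. by rewrite -sum_xyz; ring. Qed.

Lemma curve_x3 : x ^+ 3 = (1 + w *+ 2) * x ^+ 2 + (1 + w *+ 2) * e * x + e.
Proof.
rewrite -{1}sum_xyz -[_ * e]opprK -mulNr -elem2 /e; ring.
Qed.

Lemma curve_y2 : y ^+ 2 =
  (1 + w *+ 2 - x) * y + ((1 + w *+ 2) * e + (1 + w *+ 2) * x - x ^+ 2).
Proof.
rewrite -[_ * e]opprK -mulNr -elem2 -sum_xyz; ring.
Qed.

Local Notation ev := (aev w e x y).

Let evD := aev_add w e x y.
Let evM := aev_mul w3 curve_x3 curve_y2.
Let evN := aev_opp w3 curve_x3 curve_y2.
Let evx := aev_x w e x y.
Let evy := aev_y w e x y.
Let eve := aev_e w e x y.

Let evz : ev az = z.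
Proof. by rewrite (aev_z w3 curve_x3 curve_y2) zE. Qed.

Let evC c : ev (acst c) = eev w c := aev_cst w e x y c.

Let ev1 : ev a1 = 1.
Proof. by rewrite evC eev1. Qed.

Let w_cube : w ^+ 3 = 1.
Proof.
have -> : w ^+ 3 = 1 + (w - 1) * (w ^+ 2 + w + 1) by ring.
by rewrite w3 mulr0 addr0.
Qed.

Lemma eev_exp k : eev w (eis_exp k) = w ^+ k.
Proof.
rewrite [in RHS](divn_eq k 3) exprD mulnC exprM w_cube expr1n mul1r /eis_exp.
have : (k %% 3 < 3)%N by rewrite ltn_pmod.
have z0 : zev C 0%bz = 0 by [].
have z1 : zev C 1%bz = 1 by [].
have zN1 : zev C (-1)%bz = -1 by [].
case: (k %% 3)%N => [|[|[|//]]] _; rewrite /= /eev /= ?z0 ?z1 ?zN1.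
- by rewrite mul0r addr0.
- by rewrite mul1r add0r.
- by apply/eqP; rewrite -subr_eq0 -[X in _ == X]oppr0 -w3; apply/eqP; ring.
Qed.

Lemma vb_conj k b : e * (ev (vc k b))^* = ev (vb k b).
Proof.
rewrite /vc /vb (_ : vc_table = vtable vc0); last by vm_compute.
rewrite (_ : vb_table = vtable vb0); last by vm_compute.
rewrite !vlookup_table /vc0 /vb0; set j := (k %% 6)%N.
rewrite !evM !evC !eev_exp rmorphM rmorphXn /= wJ -exprM mulrCA; congr (_ * _).
rewrite /entry /avec; have : (j %% 3 < 3)%N by rewrite ltn_pmod.
by case: (j %% 3)%N => [|[|[|//]]] _ /=; case: (odd j); case: b;
  rewrite !(evD, evN, evM, evx, evy, evz, ev1, eve) !(rmorphD, rmorphN, rmorph1) /=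
    !(mulrDr, mulrN, mulr1) ?exJ ?eyJ ?ezJ.
Qed.

Definition hn (k l : nat) : C := w ^+ sq3 l * ev (vc k (odd l)).
Definition h6 (k l : 'I_6) : C := hn k l / kappa.

Lemma hn_modl k l : hn (k %% 6)%N l = hn k l.
Proof. by rewrite /hn /vc /vlookup modn_mod. Qed.

Lemma hn_modr k l : hn k (l %% 6)%N = hn k l.
Proof. by rewrite /hn /sq3 modn_dvdm // odd_mod. Qed.

Lemma hnE k l : hn k l = ev (hc k l).
Proof. by rewrite /hn evM evC eev_exp. Qed.

Lemma hbE k l : e * (hn k l)^* = ev (hb k l).
Proof.
by rewrite /hn rmorphM rmorphXn /= wJ -exprM mulrCA vb_conj evM evC eev_exp.
Qed.

Let kappa_neq0 : kappa != 0.
Proof. by apply/eqP => k0; move/eqP: kappa2; rewrite k0 expr0n /= eq_sym pnatr_eq0. Qed.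

Let e_neq0 : e != 0.
Proof.
have unit_neq0 u : u * u^* = 1 -> u != 0 :> C.
  by move=> uJ; apply/eqP => u0; move/eqP: uJ; rewrite u0 mul0r eq_sym oner_eq0.
by rewrite /e !mulf_neq0 ?unit_neq0.
Qed.

Lemma h6_dot k l k' l' : hn k l / kappa * (hn k' l' / kappa)^* =
  ev (amul (hc k l) (hb k' l')) / (12%:R * e).
Proof.
rewrite evM -hnE -hbE rmorphM fmorphV /= kappaJ -kappa2.
by field; rewrite kappa_neq0 e_neq0.
Qed.

Let valD (a b : 'I_6) : nat_of_ord (a + b) = ((a + b) %% 6)%N.
Proof. by []. Qed.

Let valB (a b : 'I_6) : nat_of_ord (a - b) = ((a + (6 - b)) %% 6)%N.
Proof. by rewrite /= modnDmr. Qed.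

Lemma h6_sum (F : nat -> aring) (t : 'I_6) (G : 'I_6 -> C) :
  aeq (asum 6 F) (delta12 t) ->
  (forall s, G s = ev (F s) / (12%:R * e)) ->
  \sum_s G s = (t == 0)%:R.
Proof.
move=> /aev_eq - /(_ _ _ _ _ _ w3 curve_x3 curve_y2) sumF GF.
under eq_bigr do rewrite GF; rewrite -mulr_suml -aev_sum sumF.
case: t {sumF} => -[|t] lt_t; last by rewrite [ev _]/(0 : C) mul0r.
have -> : delta12 (Ordinal lt_t) = amul (acst (12, 0)%bz) ae by [].
rewrite evM evC eve /eev mul0r addr0.
rewrite (_ : zev C _ = 12%:R) // divff //.
by rewrite mulf_neq0 // pnatr_eq0.
Qed.

Lemma perfect_curve : perfect (bell h6).
Proof.
have /andP[/andP[/allP c1 /allP c2] /allP c3] := check_unitarity.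
have I6 (k : 'I_6) : (k : nat) \in iota 0 6 by rewrite mem_iota /= ltn_ord.
apply: perfect_bell => k t.
- apply: (h6_sum (allP (c1 _ (I6 k)) _ (I6 t))) => s.
  by rewrite -h6_dot /h6 valD hn_modr.
- apply: (h6_sum (allP (c2 _ (I6 k)) _ (I6 t))) => s.
  by rewrite -h6_dot /h6 valD hn_modl.
- apply: (h6_sum (allP (c3 _ (I6 k)) _ (I6 t))) => s.
  rewrite -h6_dot /h6 !(valB, valD) !hn_modl hn_modr.
  by rewrite -(hn_modl (_ %% 6 + _)%N) modnDml hn_modl.
Qed.

Lemma aPhiE (V : nat -> bool -> aring) (m : nat) (g E D c : 'I_6) :
  (forall k b, V (k %% 6)%N b = V k b) ->
  let u k l := w ^+ (m * sq3 l) * ev (V k (odd l)) in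
  \sum_(p < 6) \sum_(s < 6) u p s * u (g + (6 - p))%N (s + D)%N *
    u (p + (6 - E))%N (c + (6 - s))%N *
    u (g + (6 - p) + E)%N (c + (6 - s) + (6 - D))%N =
  ev (aPhi (W_lookup (mkW V)) m g E D c).
Proof.
move=> Vmod u; rewrite /aPhi evD !evM !evC !W_lookup_table // !aev_sum !mulr_sumr.
rewrite -big_split /=; apply: eq_bigr => p _; rewrite !evM.
rewrite !pair_lookup_table // !evM.
pose A s := (m * (sq3 s + sq3 (s + D) + sq3 (c + (6 - s)) +
  sq3 (c + (6 - s) + (6 - D))))%N.
pose X b := ev (V p b) * ev (V (g + (6 - p))%N (b (+) odd D)) *
  (ev (V (p + (6 - E))%N (odd c (+) b)) *
   ev (V (g + (6 - p) + E)%N (odd c (+) b (+) odd D))).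
rewrite (eq_bigr (fun s : 'I_6 => w ^+ A s * X (odd s))) => [|s _]; last first.
  rewrite /u /A /X !mulnDr !exprD !oddD !oddB ?(ltnW (ltn_ord _)) //=.
  by ring.
rewrite /zsum -/(A 0%N) !big_ord_recl big_ord0 !eev_add !eev_exp /bump /=.
by rewrite -!/(A _) -!/(X _); ring.
Qed.

Let vc_mod k b : vc (k %% 6)%N b = vc k b.
Proof. by rewrite /vc /vlookup modn_mod. Qed.

Let vb_mod k b : vb (k %% 6)%N b = vb k b.
Proof. by rewrite /vb /vlookup modn_mod. Qed.

Lemma kappa_Phi g E D c :
  kappa ^+ 4 * Phi h6 g E D c = ev (aPhi (W_lookup (mkW vc)) 1 g E D c).
Proof.
rewrite -(aPhiE _ _ _ _ _ vc_mod) mulr_sumr; apply: eq_bigr => p _.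
rewrite mulr_sumr; apply: eq_bigr => s _.
rewrite /h6 !(valB, valD) !(hn_modl, hn_modr).
have -> : hn (((g + (6 - p)) %% 6) + E)%N ((c + (6 - s)) %% 6 + (6 - D))%N =
    hn (g + (6 - p) + E)%N (c + (6 - s) + (6 - D))%N.
  by rewrite -hn_modl modnDml hn_modl -hn_modr modnDml hn_modr.
by rewrite /hn !mul1n; field.
Qed.

Lemma kappa_PhiJ g E D c : e ^+ 4 * kappa ^+ 4 * (Phi h6 g E D c)^* =
  ev (aPhi (W_lookup (mkW vb)) 2 g E D c).
Proof.
rewrite -(aPhiE _ _ _ _ _ vb_mod) rmorph_sum mulr_sumr; apply: eq_bigr => p _.
rewrite rmorph_sum mulr_sumr; apply: eq_bigr => s _.
rewrite /h6 !(valB, valD) !(hn_modl, hn_modr).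
have -> : hn (((g + (6 - p)) %% 6) + E)%N ((c + (6 - s)) %% 6 + (6 - D))%N =
    hn (g + (6 - p) + E)%N (c + (6 - s) + (6 - D))%N.
  by rewrite -hn_modl modnDml hn_modl -hn_modr modnDml hn_modr.
have ub k l : w ^+ (2 * sq3 l) * ev (vb k (odd l)) = e * (hn k l)^*.
  by rewrite hbE evM evC eev_exp.
by rewrite !ub !rmorphM !fmorphV /= kappaJ; field.
Qed.

Lemma inv_klein_value :
  e ^+ 4 * kappa ^+ 8 * LUinv (bell h6) 1%g kl1 kl2 kl3 = 6%:R * ev klein_value.
Proof.
have valN (a : 'I_6) : nat_of_ord (- a) = neg6 a by [].
have mul6 q s : ev q = e ^+ 4 * kappa ^+ 8 * s ->
  e ^+ 4 * kappa ^+ 8 * (6%:R * s) = 6%:R * ev q by move=> ->; ring.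
rewrite -(aev_eq w3 curve_x3 curve_y2 check_klein) inv_bell; apply: mul6.
rewrite /aKlein aev_sum mulr_sumr.
apply: eq_bigr => g _; rewrite aev_sum mulr_sumr; apply: eq_bigr => E _.
rewrite aev_sum mulr_sumr; apply: eq_bigr => D _.
rewrite aev_sum mulr_sumr; apply: eq_bigr => c _.
by rewrite evM -!valN -kappa_Phi -kappa_PhiJ Psi_Phi; ring.
Qed.

(** The common factor 31104 is split into small ones because [n%:R] takes a unary numeral. *)
Lemma ev_klein_value : ev klein_value = 12%:R * (12%:R * (12%:R * (2%:R * (9%:R *
  (e ^+ 2 * (15%:R + 8%:R * (1 + w *+ 2) * e + 58%:R * e ^+ 2 -
             8%:R * (1 + w *+ 2) * e ^+ 3 + 15%:R * e ^+ 4)))))).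
Proof.
pose k0 : aring := [:: [:: [:: (0, 0); (0, 0); (15, 0); (8, 16); (58, 0);
  (-8, -16); (15, 0)]]]%bz.
pose cst n := acst (n, 0)%bz.
have zN n (m : nat) : n = Z.of_nat m -> zev C n = m%:R.
  by move=> ->; rewrite /zev (Z_of_intK (Posz m) : int_of_Z (Z.of_nat m) = m).
have cstE n (m : nat) : n = Z.of_nat m -> ev (cst n) = m%:R.
  by move=> /zN nm; rewrite evC /eev nm mul0r addr0.
rewrite (_ : klein_value = amul (cst 12) (amul (cst 12) (amul (cst 12)
  (amul (cst 2) (amul (cst 9) k0))))%bz); last by vm_compute.
rewrite !evM (@cstE 12%bz 12) // (@cstE 2%bz 2) // (@cstE 9%bz 9) //.
do 5!congr (_ * _).
rewrite /aev /xev /kev /k0 /pev /eev.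
rewrite (zev_opp C 8) (zev_opp C 16) (@zN 15%bz 15) // (@zN 8%bz 8) //.
by rewrite (@zN 16%bz 16) // (@zN 58%bz 58) // (@zN 0%bz 0) //; ring.
Qed.

Lemma inv_curve : LUinv (bell h6) 1%g kl1 kl2 kl3 * e ^+ 2 =
  9%:R * (15%:R + 8%:R * (1 + w *+ 2) * e + 58%:R * e ^+ 2 -
    8%:R * (1 + w *+ 2) * e ^+ 3 + 15%:R * e ^+ 4).
Proof.
move: inv_klein_value; rewrite ev_klein_value.
have -> : kappa ^+ 8 = 12%:R ^+ 4 by rewrite (exprM _ 2 4) kappa2.
move=> K; have nz : e ^+ 2 * 12%:R ^+ 4 != 0.
  by rewrite mulf_neq0 ?expf_neq0 // pnatr_eq0.
apply: (mulfI nz).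
transitivity (e ^+ 4 * 12%:R ^+ 4 * LUinv (bell h6) 1%g kl1 kl2 kl3); first by ring.
by rewrite K; ring.
Qed.

End Curve.

(** * Infinitely many classes in dimension six *)

Section Six.
Variable R : realType.
Local Notation C := R[i].
Local Notation q := (Num.sqrt 3%:R : R).
Implicit Types (u v : R).

Lemma complex_eq (a b c d : R) : a = c -> b = d -> (a +i* b)%C = (c +i* d)%C.
Proof. by move=> -> ->. Qed.

Let q2 : q ^+ 2 = 3%:R. Proof. by rewrite sqr_sqrtr // ler0n. Qed.
Let q_ge0 : 0 <= q. Proof. exact: sqrtr_ge0. Qed.
Let q_le2 : q <= 2%:R.
Proof.
by rewrite -(ler_pXn2r (_ : 0 < 2)%N) ?nnegrE ?ler0n // q2 -natrX ler_nat.
Qed.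

Definition omega : C := (- 2%:R^-1 +i* (q / 2%:R))%C.
Definition kappa : C := (2%:R * q +i* 0)%C.

(* Given x on the unit circle, y and z are the two points of the unit circle with
   midpoint W / 2, where W = i sqrt 3 - x; [nu] is the square of the modulus of W
   and u the imaginary part of x. *)
Definition su u := Num.sqrt (1 - u ^+ 2).
Definition nu u := 4%:R - 2%:R * q * u.
Definition tu u := Num.sqrt ((nu u)^-1 - 4%:R^-1).

Definition cx u : C := (- su u +i* u)%C.
Definition cy u : C :=
  ((su u / 2%:R - tu u * (q - u)) +i* ((q - u) / 2%:R + tu u * su u))%C.
Definition cz u : C :=
  ((su u / 2%:R + tu u * (q - u)) +i* ((q - u) / 2%:R - tu u * su u))%C.

(** The imaginary part of e = xyz: since y and z are W (1/2 + i t) and W (1/2 - i t) with t =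
    [tu u], their product is W^2 / [nu u], so e = x W^2 / [nu u]. *)
Definition im_e u := - (q - 2%:R * q * u ^+ 2 + 2%:R * u ^+ 3) / (2%:R - q * u).

Definition T6 u := bell (h6 omega (cx u) (cy u) (cz u) kappa).

Lemma qu_bound u : 0 < u -> u < 8%:R^-1 -> 0 <= q * u <= 4%:R^-1.
Proof.
move=> u0 u1; apply/andP; split; first by rewrite mulr_ge0 // ltW.
apply: (@le_trans _ _ (2%:R * 8%:R^-1)); last by lra.
by apply: ler_pM => //; apply: ltW.
Qed.

Section OnePoint.
Variable u : R.
Hypotheses (u0 : 0 < u) (u1 : u < 8%:R^-1).

Let u_lt1 : u < 1.
Proof. by apply: lt_trans u1 _; rewrite invf_lt1 ?ltr0n ?ltr1n. Qed.

Let s2 : su u ^+ 2 = 1 - u ^+ 2.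
Proof. by rewrite sqr_sqrtr // subr_ge0 expr_le1 // ltW. Qed.

Let qu : 0 <= q * u <= 4%:R^-1.
Proof. exact: qu_bound. Qed.

Let nu_gt0 : 0 < nu u.
Proof. by rewrite /nu; move: qu; lra. Qed.

Let nu_le4 : nu u <= 4%:R.
Proof. by rewrite /nu; move: qu; lra. Qed.

Let t2 : nu u * (4%:R^-1 + tu u ^+ 2) = 1.
Proof.
rewrite sqr_sqrtr; first by field; rewrite gt_eqF.
by rewrite subr_ge0 lef_pV2 // posrE ltr0n.
Qed.

Let nuE : nu u = su u ^+ 2 + (q - u) ^+ 2.
Proof. by rewrite s2 sqrrB q2 /nu; ring. Qed.

Let omega_root : omega ^+ 2 + omega + 1 = 0.
Proof. by rewrite expr2; apply: complex_eq => /=; move: q2; lra. Qed.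

Let omegaJ : omega^* = omega ^+ 2.
Proof. by rewrite expr2; apply: complex_eq => /=; move: q2; lra. Qed.

Let sum_c : cx u + cy u + cz u = 1 + omega *+ 2.
Proof. by rewrite mulr2n; apply: complex_eq => /=; field. Qed.

Let nat_c n : n%:R = (n%:R +i* 0)%C :> C.
Proof. exact: esym (rmorph_nat (real_complex R) n). Qed.

Let norm2 (a b : R) : a ^+ 2 + b ^+ 2 = 1 -> (a +i* b)%C * ((a +i* b)%C)^* = 1.
Proof. by move=> ab; apply: complex_eq => /=; rewrite -?ab; ring. Qed.

Let cxJ : cx u * (cx u)^* = 1.
Proof. by apply: norm2; rewrite sqrrN s2; ring. Qed.

Let cyJ : cy u * (cy u)^* = 1.
Proof. by apply: norm2; rewrite -[RHS]t2 nuE; field. Qed.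

Let czJ : cz u * (cz u)^* = 1.
Proof. by apply: norm2; rewrite -[RHS]t2 nuE; field. Qed.

Let kappa2 : kappa ^+ 2 = 12%:R.
Proof.
by rewrite nat_c expr2; apply: complex_eq => /=; move: q2; lra.
Qed.

Let kappaJ : kappa^* = kappa.
Proof. by apply: complex_eq => //=; rewrite oppr0. Qed.

Lemma perfect_T6 : perfect (T6 u).
Proof. exact: perfect_curve. Qed.

Let e := cx u * cy u * cz u.

Let cyzE : cy u * cz u * ((nu u) +i* 0)%C =
  (su u +i* (q - u))%C * (su u +i* (q - u))%C.
Proof.
have yE : cy u = (su u +i* (q - u))%C * (2%:R^-1 +i* tu u)%C.
  by apply: complex_eq; field.
have zE : cz u = (su u +i* (q - u))%C * (2%:R^-1 +i* (- tu u))%C.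
  by apply: complex_eq; field.
have tE : (2%:R^-1 +i* tu u)%C * (2%:R^-1 +i* (- tu u))%C * ((nu u) +i* 0)%C = 1.
  by apply: complex_eq => /=; [rewrite -[RHS]t2; field | ring].
by rewrite yE zE mulrACA -[LHS]mulrA tE mulr1.
Qed.

Let eE : exists2 a, e = (a +i* im_e u)%C & a ^+ 2 + im_e u ^+ 2 = 1.
Proof.
have d0 : 2%:R - q * u != 0 by apply/eqP; move: qu; lra.
have d1 : nu u = 2%:R * (2%:R - q * u) by rewrite /nu; ring.
have eN : e * ((nu u) +i* 0)%C =
    cx u * ((su u +i* (q - u))%C * (su u +i* (q - u))%C).
  by rewrite -cyzE /e !mulrA.
have eJ : e * e^* = 1.
  by rewrite /e !rmorphM mulrACA (mulrACA (cx u)) cxJ cyJ czJ !mulr1.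
case: e eN eJ => a b [_ bN] [ab _].
suff bE : b = im_e u by exists a; rewrite -?bE // -ab; ring.
move: bN; rewrite mulr0 add0r d1 => bN.
have {}bN : b * (2%:R - q * u) = - (q - 2%:R * q * u ^+ 2 + 2%:R * u ^+ 3).
  apply: (mulIf (_ : 2%:R != 0)); first by rewrite pnatr_eq0.
  transitivity (b * (2%:R * (2%:R - q * u))); first by ring.
  by rewrite bN; ring: s2 q2.
by rewrite /im_e -bN mulfK.
Qed.

(** Let b be the imaginary part of e. As e has modulus 1, dividing the quartic of [inv_curve] by e^2
    leaves e^2 + e^-2 = 2 - 4 b^2 and e^-1 - e = -2ib, and 1 + 2w = i sqrt 3. *)
Lemma inv_T6 : LUinv (T6 u) 1%g kl1 kl2 kl3 =
  ((9%:R * (88%:R + 16%:R * q * im_e u - 60%:R * im_e u ^+ 2)) +i* 0)%C.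
Proof.
have := inv_curve omega_root omegaJ sum_c cxJ cyJ czJ kappa2 kappaJ.
rewrite -/e -/(T6 u) => invE.
have [a ea a2] := eE.
have e2_neq0 : e ^+ 2 != 0.
  rewrite expf_neq0 // ea; apply/eqP => -[a0 b0]; move/eqP: a2.
  by rewrite a0 b0 !expr0n addr0 eq_sym oner_eq0.
apply: (mulIf e2_neq0); rewrite invE ea !exprS expr0 mulr1.
rewrite !nat_c mulr2n; move: (im_e u) a2 => b a2 {ea}.
have {}a2 : a ^+ 2 = 1 - b ^+ 2 by rewrite -a2; ring.
have h0 : - 2%:R^-1 - 2%:R^-1 = -1 :> R by field.
have h1 : q / 2%:R + q / 2%:R = q by field.
by apply: complex_eq => /=; rewrite h0 h1; ring: a2.
Qed.

End OnePoint.

Let q_ge1 : 1 <= q.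
Proof. by rewrite -(ler_pXn2r (_ : 0 < 2)%N) ?nnegrE ?ler01 // q2 expr1n ler1n. Qed.

Let quv u v : 0 < u -> u < 8%:R^-1 -> 0 < v -> v < 8%:R^-1 ->
  0 <= q * u * v <= 32%:R^-1.
Proof.
move=> u0 u1 v0 v1; have /andP[qu0 qu1] := qu_bound u0 u1.
apply/andP; split; first by rewrite mulr_ge0 // ltW.
apply: (@le_trans _ _ (4%:R^-1 * 8%:R^-1)); last by lra.
by apply: ler_pM => //; apply: ltW.
Qed.

Lemma im_e_lt0 u : 0 < u -> u < 8%:R^-1 -> im_e u < 0.
Proof.
move=> u0 u1; rewrite /im_e mulNr oppr_lt0 divr_gt0 //; last first.
  by have := qu_bound u0 u1; lra.
have := quv u0 u1 u0 u1; have : 0 < u ^+ 3 by rewrite exprn_gt0.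
by move: q_ge1; lra.
Qed.

(** After cross-multiplication the difference is u - v times a cofactor with constant term 3; the
    bound 1/8 keeps this cofactor positive. *)
Lemma im_e_inj u v : 0 < u -> u < 8%:R^-1 -> 0 < v -> v < 8%:R^-1 ->
  im_e u = im_e v -> u = v.
Proof.
move=> u0 u1 v0 v1 /eqP.
have du r : 0 < r -> r < 8%:R^-1 -> 2%:R - q * r != 0.
  by move=> r0 r1; apply/eqP; have := qu_bound r0 r1; lra.
rewrite /im_e eqr_div ?du // => /eqP E.
have : (u - v) * (3%:R - 4%:R * (q * u + q * v) + 6%:R * (u * v) +
    4%:R * (u ^+ 2 + u * v + v ^+ 2) -
    2%:R * (q * u * v * u + q * u * v * v)) = 0.
  transitivity (- (q - 2%:R * q * v ^+ 2 + 2%:R * v ^+ 3) * (2%:R - q * u) -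
    - (q - 2%:R * q * u ^+ 2 + 2%:R * u ^+ 3) * (2%:R - q * v)).
    by ring: q2.
  by rewrite E subrr.
move/eqP; rewrite mulf_eq0 subr_eq0 => /orP[/eqP //|/eqP F].
have /andP[k0 k1] := quv u0 u1 v0 v1.
have ku r : 0 < r -> r < 8%:R^-1 -> q * u * v * r <= 32%:R^-1 * 8%:R^-1.
  by move=> r0 r1; apply: ler_pM => //; apply: ltW.
have := ku u u0 u1; have := ku v v0 v1.
have := qu_bound u0 u1; have := qu_bound v0 v1.
have uv : 0 <= u * v by rewrite mulr_ge0 // ltW.
by move: F uv (sqr_ge0 u) (sqr_ge0 v); lra.
Qed.

(** Distinct b and b' give the same value of the quadratic only if 60 (b + b') = 16 sqrt 3, which is
    impossible for negative b and b'. *)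
Lemma inv_T6_inj u v : 0 < u -> u < 8%:R^-1 -> 0 < v -> v < 8%:R^-1 ->
  LUinv (T6 u) 1%g kl1 kl2 kl3 = LUinv (T6 v) 1%g kl1 kl2 kl3 -> u = v.
Proof.
move=> u0 u1 v0 v1; rewrite !inv_T6 // => -[] /(mulfI _) E.
apply: im_e_inj => //.
have {}E : (im_e u - im_e v) * (16%:R * q - 60%:R * (im_e u + im_e v)) = 0.
  have := E; rewrite pnatr_eq0 => /(_ isT) {}E.
  by move: E; lra.
move/eqP: E; rewrite mulf_eq0 subr_eq0 => /orP[/eqP //|/eqP F].
have := im_e_lt0 u0 u1; have := im_e_lt0 v0 v1; move: q_ge0; lra.
Qed.

Lemma six_classes (n : nat) : exists f : 'I_n -> 'M[C]_(6 * 6),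
  (forall k, two_unitary (f k)) /\
  (forall k l, k != l -> ~ LU_equiv (f k) (f l)).
Proof.
(* Distinct points of the interval from 0 to 1/8. *)
pose u (k : 'I_n) : R := (k + 9)%:R^-1.
have u0 k : 0 < u k by rewrite invr_gt0 ltr0n addnS.
have u1 k : u k < 8%:R^-1.
  by rewrite ltf_pV2 ?posrE ?ltr0n ?addnS // ltr_nat !ltnS leq_addl.
apply: (@family_of_inv R 6 n 4 1%g kl1 kl2 kl3 (fun k => T6 (u k))).
  by move=> k; apply: perfect_T6.
move=> k l /inv_T6_inj E; apply: val_inj; apply: (@addIn 9); apply/eqP.
by rewrite -(eqr_nat R); apply/eqP/invr_inj/E.
Qed.
End Six.

(** * Orthogonal Latin squares with one free phase *)

Definition is_mols (T : Type) (L M : T -> T -> T) : Prop :=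
  [/\ forall i, injective (L i), forall a, injective (L^~ a),
      forall i, injective (M i), forall a, injective (M^~ a) &
      forall i a i' a', L i a = L i' a' -> M i a = M i' a' -> i = i' /\ a = a'].

Definition has_mols (T : Type) : Prop := exists L M : T -> T -> T, is_mols L M.

Definition leg d (L M : 'I_d -> 'I_d -> 'I_d) (l : 'I_4) (c : 'I_d * 'I_d) : 'I_d :=
  nth c.1 [:: c.1; c.2; L c.1 c.2; M c.1 c.2] l.

(* There are d^2 >= 4d cells and 4d lines, and the line sums are linearly
   dependent because rows and columns have the same total. *)
Lemma net_trade_rat d (L M : 'I_d -> 'I_d -> 'I_d) : (4 <= d)%N ->
  exists2 r : 'I_d * 'I_d -> rat,
    exists c, r c != 0 & forall l v, \sum_(c | leg L M l c == v) r c = 0.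
Proof.
move=> d4; pose cell := ('I_d * 'I_d)%type; pose N := #|{: cell}|.
pose line := ('I_4 * 'I_d)%type; pose K := #|{: line}|.
have NE : N = (d * d)%N by rewrite /N card_prod card_ord.
have KE : K = (4 * d)%N by rewrite /K card_prod !card_ord.
pose A : 'M[rat]_(N, K) := \matrix_(c, k)
  (leg L M (enum_val k).1 (enum_val c) == (enum_val k).2)%:R.
pose o4 k : 'I_4 := inord k.
(* Every cell lies on exactly one line of each class, so the indicator of the rows minus that of the
   columns is killed by [A]. *)
pose u : 'cV[rat]_K := \col_k (((enum_val k).1 == o4 0%N)%:R -
  ((enum_val k).1 == o4 1%N)%:R).
have Au : A *m u = 0.
  apply/matrixP => c k; rewrite !mxE.
  under eq_bigr do rewrite !mxE.
  rewrite (reindex (@enum_rank line)) /=; last first.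
    by exists enum_val => x _; rewrite ?enum_rankK ?enum_valK.
  under eq_bigr do rewrite enum_rankK mulrBr.
  rewrite sumrB; apply/eqP; rewrite subr_eq0; apply/eqP.
  have one l : \sum_(i : line) (leg L M i.1 (enum_val c) == i.2)%:R * (i.1 == l)%:R = 1 :> rat.
    rewrite (bigD1 (l, leg L M l (enum_val c))) //= !eqxx mulr1 big1 ?addr0 //.
    move=> -[l' v] /=; rewrite xpair_eqE; case: (l' =P l) => [->|_]; rewrite ?mulr0 //=.
    by rewrite eq_sym => /negPf->; rewrite mul0r.
  by rewrite !one.
have nfull : ~~ row_full A.
  apply/negP => /row_fullP[B BA].
  have u0 : u = 0 by rewrite -[u]mul1mx -BA -mulmxA Au mulmx0.
  have v0 : 'I_d by apply: (@Ordinal _ 0); apply: leq_trans d4.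
  move/matrixP/(_ (enum_rank (o4 0%N, v0)) 0)/eqP: u0; rewrite !mxE enum_rankK eqxx /=.
  by rewrite (_ : o4 0%N == o4 1%N = false) ?subr0 ?oner_eq0 // -val_eqE /= !inordK.
have rkA : (\rank A < N)%N.
  have : (\rank A < K)%N by rewrite ltn_neqAle nfull rank_leq_col.
  by move/leq_trans; apply; rewrite NE KE leq_mul2r d4 orbT.
have /rowV0Pn[r rK r0] : kermx A != 0.
  by rewrite -mxrank_eq0 mxrank_ker -lt0n subn_gt0.
exists (fun c => r 0 (enum_rank c)).
  have /rV0Pn[c rc] := r0; exists (enum_val c); by rewrite enum_valK.
move=> l v; move/sub_kermxP/matrixP/(_ 0 (enum_rank (l, v))): rK; rewrite !mxE => rA.
rewrite -[RHS]rA [RHS](reindex (@enum_rank cell)) /=; last first.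
  by exists enum_val => x _; rewrite ?enum_rankK ?enum_valK.
rewrite [LHS]big_mkcond; apply: eq_bigr => c _; rewrite mxE !enum_rankK /=.
by case: eqP; rewrite ?mulr1 ?mulr0.
Qed.

Lemma common_denominator (I : finType) (r : I -> rat) :
  exists2 D : int, D != 0 & exists g : I -> int, forall i, (g i)%:~R = D%:~R * r i.
Proof.
exists (\prod_i denq (r i)); first by apply/prodf_neq0 => i _; rewrite denq_eq0.
exists (fun i => numq (r i) * \prod_(j | j != i) denq (r j)) => i.
by rewrite [in RHS](bigD1 i) //= !rmorphM /= numqE; ring.
Qed.

Lemma net_trade d (L M : 'I_d -> 'I_d -> 'I_d) : (4 <= d)%N ->
  exists p q : 'I_d * 'I_d -> nat, (exists c, p c != q c) /\
    forall l v, (\sum_(c | leg L M l c == v) p c = \sum_(c | leg L M l c == v) q c)%N.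
Proof.
move=> d4; have [r [c0 rc0] r0] := net_trade_rat L M d4.
have [D D0 [g gE]] := common_denominator r.
exists (fun c => `|Num.max (g c) 0|%N), (fun c => `|Num.max (- g c) 0|%N); split.
  exists c0; have : g c0 != 0.
    by rewrite -(intr_eq0 rat) gE mulf_neq0 // intr_eq0.
  by case: (g c0) => [[|n]|n].
move=> l v; apply/eqP; rewrite -(eqr_nat rat) !natr_sum -subr_eq0 -sumrB.
rewrite (eq_bigr (fun c => D%:~R * r c)) => [|c _].
  by rewrite -mulr_sumr r0 mulr0.
rewrite -gE; case: (g c) => [[|n]|n]; rewrite ?subr0 //.
by rewrite (_ : `|Num.max (Negz n) 0|%N = 0%N) // sub0r NegzE opprK mulrNz.
Qed.

Section Trade.
Variables (T : finType).

Lemma tuple_of_mult (p : T -> nat) n : (\sum_c p c)%N = n ->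
  exists t : n.-tuple T, forall c, count_mem c t = p c.
Proof.
pose s := flatten [seq nseq (p c) c | c <- enum T].
have cs (a : pred T) : count a s = (\sum_(c | a c) p c)%N.
  rewrite /s count_flatten -map_comp sumnE big_map [RHS]big_mkcond -big_enum /=.
  by apply: eq_bigr => c _; rewrite /= count_nseq; case: (a c); rewrite ?mul1n.
move=> pn; have sn : size s == n by rewrite -count_predT cs -pn.
exists (Tuple sn) => c; rewrite cs (bigD1 c) /=; last by rewrite eqxx.
by rewrite big1 ?addn0 // => c'; case: eqP.
Qed.

Lemma count_mult (t : seq T) (a : pred T) :
  count a t = (\sum_(c | a c) count_mem c t)%N.
Proof.
elim: t => [|x t IHt] /=; first by rewrite big1.
rewrite IHt big_split /=; congr (_ + _)%N.
rewrite big_mkcond (bigD1 x) //= eqxx big1 ?addn0 => [|c /negPf]; first by case: (a x).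
by rewrite eq_sym => ->; case: (a c).
Qed.

End Trade.

(** The two multisets of the trade are listed as [l] and [r]. Equal line sums make their images
    under each leg rearrangements of each other, and [s h] is such a rearrangement for leg h. *)
Lemma net_perms d (L M : 'I_d -> 'I_d -> 'I_d) : (4 <= d)%N ->
  exists n (l r : n.-tuple ('I_d * 'I_d)) (s : 'I_4 -> 'S_n),
    (exists c, count_mem c l != count_mem c r) /\
    forall h k, leg L M h (tnth r k) = leg L M h (tnth l (s h k)).
Proof.
move=> d4; have [p [q [[c0 pq] sum_pq]]] := net_trade L M d4.
(* The lines of a single class already partition the cells. *)
have total : (\sum_c p c = \sum_c q c)%N.
  rewrite (partition_big (leg L M ord0) predT) //.
  rewrite [RHS](partition_big (leg L M ord0) predT) //.
  by apply: eq_bigr => v _; apply: sum_pq.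
exists (\sum_c p c)%N.
have [l lp] := tuple_of_mult (erefl (\sum_c p c)%N).
have [r rq] := tuple_of_mult (esym total); exists l, r.
have leg_perm h : perm_eq [tuple of map (leg L M h) r] [tuple of map (leg L M h) l].
  apply/seq.permP => a; rewrite !count_map !count_mult.
  have lines (f : 'I_d * 'I_d -> nat) :
      (\sum_(c | preim (leg L M h) a c) f c =
       \sum_(v | a v) \sum_(c | leg L M h c == v) f c)%N.
    rewrite (partition_big (leg L M h) a) //; apply: eq_bigr => v av.
    by apply: eq_bigl => c /=; case: eqP => [->|]; rewrite ?andbF ?av.
  rewrite !lines; apply: eq_bigr => v _.
  by under eq_bigr do rewrite rq; under [RHS]eq_bigr do rewrite lp.
have [s sP] : exists s : 'I_4 -> 'S_(\sum_c p c)%N,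
    forall h k, leg L M h (tnth r k) = leg L M h (tnth l (s h k)).
  have /fin_all_exists[s sP] h : exists s : 'S_(\sum_c p c)%N,
      forall k, leg L M h (tnth r k) = leg L M h (tnth l (s k)).
    have /tuple_permP[s sE] := leg_perm h; exists s => k.
    have := congr1 (fun t => nth (leg L M h c0) t k) sE.
    rewrite -tnth_nth tnth_map => ->.
    by rewrite (nth_map k) ?size_enum_ord // nth_ord_enum tnth_map.
  by exists s.
exists s; split=> //; exists c0; rewrite lp rq; exact: pq.
Qed.

Section Phases.
Variables (R : realType) (d : nat) (L M : 'I_d -> 'I_d -> 'I_d).
Local Notation C := R[i].
Hypothesis LM : is_mols L M.

Definition on_net (i a j b : 'I_d) : bool := (j == L i a) && (b == M i a).

Definition net_tensor (ph : 'I_d -> 'I_d -> C) (i a j b : 'I_d) : C :=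
  (on_net i a j b)%:R * ph i a.

Lemma sum_delta (I : finType) (x : I) (F : I -> C) :
  (forall y, y != x -> F y = 0) -> \sum_y F y = F x.
Proof. by move=> F0; rewrite (bigD1 x) //= big1 ?addr0. Qed.

Lemma net_tensor_eq0 ph i a j b : (j != L i a) || (b != M i a) ->
  net_tensor ph i a j b = 0.
Proof. by rewrite /net_tensor /on_net -negb_and => /negPf->; rewrite mul0r. Qed.

(** Any two legs determine the cell, so across each cut the tensor is a permutation matrix with
    phases. *)
Lemma perfect_net ph : (forall i a, ph i a * (ph i a)^* = 1) ->
  perfect (net_tensor ph).
Proof.
case: LM => Li La Mi Ma LMi ph1.
have sq i a : net_tensor ph i a (L i a) (M i a) *
    (net_tensor ph i a (L i a) (M i a))^* = 1.
  by rewrite /net_tensor /on_net !eqxx mul1r.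
split=> [i a i' a'|i j i' j'|i b i' b'].
- rewrite (sum_delta (x := L i a)) => [|j nj]; last first.
    by apply: big1 => b _; rewrite net_tensor_eq0 ?nj ?mul0r.
  rewrite (sum_delta (x := M i a)) => [|b nb]; last first.
    by rewrite net_tensor_eq0 ?nb ?orbT ?mul0r.
  case: eqP => [<-|ni]; last first.
    rewrite [X in _ * X^*]net_tensor_eq0 ?conjC0 ?mulr0 // -negb_and.
    by apply/negP => /andP[/eqP e1 /eqP e2]; case: (LMi _ _ _ _ e1 e2).
  case: eqP => [<-|na]; first exact: sq.
  rewrite [X in _ * X^*]net_tensor_eq0 ?conjC0 ?mulr0 // -negb_and.
  by apply/negP => /andP[/eqP e1 /eqP e2]; case: (LMi _ _ _ _ e1 e2).
- have [a ja] : exists a, L i a = j by exists (invF (Li i) j); rewrite f_invF.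
  rewrite (sum_delta (x := a)) => [|a' na]; last first.
    apply: big1 => b _; rewrite net_tensor_eq0 ?mul0r // -ja.
    by rewrite (inj_eq (Li i)) eq_sym na.
  rewrite (sum_delta (x := M i a)) => [|b nb]; last first.
    by rewrite net_tensor_eq0 ?nb ?orbT ?mul0r.
  rewrite -ja; case: eqP => [<-|ni] /=; last first.
    rewrite [X in _ * X^*]net_tensor_eq0 ?conjC0 ?mulr0 //.
    by rewrite orbC (inj_eq (Ma a)) (introN eqP ni).
  case: eqP => [<-|nj]; first exact: sq.
  by rewrite [X in _ * X^*]net_tensor_eq0 ?conjC0 ?mulr0 // eq_sym (introN eqP nj).
- have [a ba] : exists a, M i a = b by exists (invF (Mi i) b); rewrite f_invF.
  rewrite exchange_big (sum_delta (x := a)) => [|a' na] /=; last first.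
    apply: big1 => j _; rewrite net_tensor_eq0 ?mul0r // -ba.
    by rewrite (inj_eq (Mi i)) [a == _]eq_sym na orbT.
  rewrite (sum_delta (x := L i a)) => [|j nj]; last first.
    by rewrite net_tensor_eq0 ?nj ?mul0r.
  rewrite -ba; case: eqP => [<-|ni] /=; last first.
    rewrite [X in _ * X^*]net_tensor_eq0 ?conjC0 ?mulr0 //.
    by rewrite (inj_eq (La a)) (introN eqP ni).
  case: eqP => [<-|nb]; first exact: sq.
  by rewrite [X in _ * X^*]net_tensor_eq0 ?conjC0 ?mulr0 // orbC eq_sym (introN eqP nb).
Qed.

Section PhaseInvariant.
Variables (n : nat) (s : 'I_4 -> 'S_n) (c0 : 'I_d * 'I_d).
Local Notation legs := ({ffun 'I_n -> 'I_d} * {ffun 'I_n -> 'I_d} *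
  {ffun 'I_n -> 'I_d} * {ffun 'I_n -> 'I_d})%type.

Definition phase_tensor (z : C) :=
  net_tensor (fun i a => z ^+ ((i, a) == c0)).

Definition phase_inv (z : C) : C :=
  LUinv (phase_tensor z) (s (o 0)) (s (o 1)) (s (o 2)) (s (o 3)).

Definition conf_valid (x : legs) : bool :=
  let: (x1, x2, x3, x4) := x in
  [forall k, on_net (x1 k) (x2 k) (x3 k) (x4 k) &&
     on_net (x1 (s (o 0) k)) (x2 (s (o 1) k)) (x3 (s (o 2) k)) (x4 (s (o 3) k))].

Definition conf_left (x : legs) : nat :=
  \sum_k ((x.1.1.1 k, x.1.1.2 k) == c0).

Definition conf_right (x : legs) : nat :=
  \sum_k ((x.1.1.1 (s (o 0) k), x.1.1.2 (s (o 1) k)) == c0).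

(* Every term of the contraction is 0 or a power of z, so nothing can cancel. *)
Definition phase_poly : {poly C} :=
  \sum_(x : legs | conf_valid x) 'X^(conf_left x + (n - conf_right x)).

(** On the unit circle the conjugate of z is its inverse, and at most n conjugated factors carry it,
    so z^n clears the negative powers. *)
Lemma phase_polyE z : z * z^* = 1 -> phase_poly.[z] = z ^+ n * phase_inv z.
Proof.
move=> zz; rewrite /phase_inv /LUinv !pair_bigA /= mulr_sumr /phase_poly horner_sum.
rewrite big_mkcond; apply: eq_bigr => -[[[x1 x2] x3] x4] _ /=.
rewrite /inv_term big_split /= -rmorph_prod /phase_tensor /net_tensor !big_split /=.
rewrite !rmorphM !rmorph_prod /= !prodrXr.
case: ifP => [/forallP valid|/negbT/forallPn[k]].
  have -> : \prod_k (on_net (x1 k) (x2 k) (x3 k) (x4 k))%:R = 1 :> C.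
    by apply: big1 => k _; have /andP[-> _] := valid k.
  have -> : \prod_k ((on_net (x1 (s (o 0) k)) (x2 (s (o 1) k)) (x3 (s (o 2) k))
      (x4 (s (o 3) k)))%:R)^* = 1 :> C.
    by apply: big1 => k _; have /andP[_ ->] := valid k; rewrite rmorph1.
  rewrite !mul1r hornerXn -rmorph_prod prodrXr /=.
  rewrite -/(conf_left (x1, x2, x3, x4)) -/(conf_right (x1, x2, x3, x4)).
  set l := conf_left _; set r := conf_right _.
  have rn : (r <= n)%N.
    rewrite -[X in (_ <= X)%N]card_ord -sum1_card; apply: leq_sum => k _.
    exact: leq_b1.
  rewrite rmorphXn /= exprD; have -> : z ^+ n = z ^+ (n - r) * z ^+ r by rewrite -exprD subnK.
  transitivity (z ^+ l * z ^+ (n - r) * (z * z^*) ^+ r); first by rewrite zz expr1n mulr1.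
  by rewrite exprMn; ring.
rewrite negb_and => /orP[nk|nk].
  by rewrite (bigD1 k) //= (negPf nk) !mul0r mulr0.
rewrite [X in _ * (_ * _ * (X * _))](bigD1 k) //=.
by rewrite (negPf nk) rmorph0 !mul0r !mulr0.
Qed.

Lemma phase_poly_coef (x : legs) : conf_valid x ->
  phase_poly`_(conf_left x + (n - conf_right x)) != 0.
Proof.
move=> vx; rewrite /phase_poly coef_sum.
under eq_bigr do rewrite coefXn; rewrite -natr_sum pnatr_eq0 -lt0n.
by rewrite (bigD1 x) //= eqxx.
Qed.

End PhaseInvariant.
End Phases.

Lemma unimodular_seq (R : realType) :
  exists2 z : nat -> R[i], injective z & forall k, z k * (z k)^* = 1.
Proof.
pose c k : R := k.+1%:R^-1.
exists (fun k => (c k +i* Num.sqrt (1 - c k ^+ 2))%C).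
  by move=> k l [/invr_inj /eqP]; rewrite eqr_nat => /eqP[].
move=> k; have c1 : 0 <= 1 - c k ^+ 2.
  by rewrite subr_ge0 expr_le1 ?invr_ge0 ?ler0n // invf_le1 ?ltr0n // ler1n.
have s2 := sqr_sqrtr c1; set t := Num.sqrt _ in s2 *.
apply/eqP; rewrite eq_complex /=; apply/andP; split; apply/eqP; last by ring.
by rewrite mulrN opprK -!expr2 s2; ring.
Qed.

(** Each value v is taken by [f] only finitely often, since P - v Q is a nonzero polynomial and the
    points [z k] are distinct. New values can therefore be chosen one at a time. *)
Lemma distinct_values (C : fieldType) (z : nat -> C) (f : nat -> C)
    (P Q : {poly C}) :
  injective z -> (forall k, P.[z k] = Q.[z k] * f k) ->
  (forall v, P != v *: Q) ->
  forall n, exists g : 'I_n -> nat, injective (f \o g).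
Proof.
move=> z_inj PQ neqPQ n.
have [t tn ut] : exists2 t : seq nat, size t = n & uniq (map f t).
  elim: n => [|n [t tn ut]]; first by exists [::].
  (* [S] vanishes at [z k] whenever [f k] has already been chosen. *)
  pose S := \prod_(v <- map f t) (P - v *: Q).
  have S0 : S != 0.
    by rewrite /S prodf_seq_neq0; apply/allP => v _; rewrite subr_eq0 neqPQ.
  have [k kS] : exists k, S.[z k] != 0.
    pose r := map z (iota 0 (size S)).
    have ur : uniq r by rewrite map_inj_uniq ?iota_uniq.
    have : ~~ all (root S) r.
      apply: contraL (leqnn (size S)) => ar; rewrite -ltnNge.
      by have := max_poly_roots S0 ar ur; rewrite size_map size_iota.
    by case/allPn=> _ /mapP[k _ ->] /= kS; exists k.
  exists (k :: t); rewrite /= ?tn // ut andbT; apply: contra kS => fk.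
  rewrite /S horner_prod (big_rem (f k)) //= hornerD hornerN hornerZ PQ.
  by rewrite [f k * _]mulrC subrr mul0r.
exists (fun i => nth 0%N t i) => i j /= E; apply: val_inj => /=.
have := nth_uniq 0 (s := map f t) (i := i) (j := j).
rewrite size_map tn !ltn_ord => /(_ isT isT ut).
by rewrite !(nth_map 0%N) ?tn // E eqxx => /esym/eqP.
Qed.

Lemma mols_classes (R : realType) (d : nat) : (4 <= d)%N -> has_mols 'I_d ->
  forall n : nat, exists f : 'I_n -> 'M[R[i]]_(d * d),
    (forall k, two_unitary (f k)) /\
    (forall k l, k != l -> ~ LU_equiv (f k) (f l)).
Proof.
move=> d4 [L [M LM]] n.
have [m [l [r [s [[c0 lr] sP]]]]] := net_perms L M d4.
have [z z_inj z1] := unimodular_seq R.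
pose T k := phase_tensor L M c0 (z k).
have PQ k : (phase_poly R L M s c0).[z k] =
    ('X^m).[z k] * phase_inv L M s c0 (z k).
  by rewrite hornerXn; apply: phase_polyE.
(* The trade itself is a valid configuration. It contributes to the exponent m plus the difference
   of the multiplicities of [c0] in [l] and [r], which is not m. *)
have neqPQ v : phase_poly R L M s c0 != v *: 'X^m.
  apply/negP => /eqP E.
  pose x h : {ffun 'I_m -> 'I_d} := [ffun k => leg L M h (tnth l k)].
  pose X := (x (o 0), x (o 1), x (o 2),
    x (o 3)).
  have vX : conf_valid L M s X.
    by apply/forallP => k; rewrite !ffunE -!sP /on_net /leg /= !eqxx.
  have := phase_poly_coef R c0 vX; rewrite E coefZ coefXn.
  have cnt (t : m.-tuple ('I_d * 'I_d)) : count_mem c0 t = (\sum_k (tnth t k == c0))%N.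
    by rewrite -sum1_count big_mkcond big_tuple; apply: eq_bigr => k _ /=; case: eqP.
  have -> : conf_left c0 X = count_mem c0 l.
    by rewrite cnt; apply: eq_bigr => k _; rewrite !ffunE /leg /= -surjective_pairing.
  have -> : conf_right s c0 X = count_mem c0 r.
    rewrite cnt; apply: eq_bigr => k _.
    by rewrite !ffunE -!sP /leg /= -surjective_pairing.
  have rm : (count_mem c0 r <= m)%N by rewrite -[X in (_ <= X)%N](size_tuple r) count_size.
  case: (_ =P m) => [E'|_]; last by rewrite mulr0 eqxx.
  by case/eqP: lr; apply: (@addIn (m - count_mem c0 r)%N); rewrite E' subnKC.
have [g g_inj] := distinct_values z_inj PQ neqPQ n.
apply: (family_of_inv (T := fun k => T (g k))) => [k|k k' E].
  apply: perfect_net => // i a; case: eqP => _; rewrite ?expr0 ?expr1 ?z1 //.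
  by rewrite mul1r conjC1.
by apply: g_inj; apply: E.
Qed.

(** * Existence of orthogonal Latin squares *)

Lemma mols_transfer (T U : Type) (f : T -> U) (g : U -> T) (L M : U -> U -> U) :
  cancel f g -> cancel g f -> is_mols L M ->
  is_mols (fun x y => g (L (f x) (f y))) (fun x y => g (M (f x) (f y))).
Proof.
move=> fK gK [Li La Mi Ma LM].
have fI := can_inj fK; have gI := can_inj gK.
split.
- by move=> i a b /gI/Li/fI.
- by move=> a i j /gI/La/fI.
- by move=> i a b /gI/Mi/fI.
- by move=> a i j /gI/Ma/fI.
- by move=> i a j b /gI E /gI /(LM _ _ _ _ E)[/fI-> /fI->].
Qed.

Lemma mols_card (T : finType) n : #|T| = n -> has_mols T -> has_mols 'I_n.
Proof.
move=> <- [L [M LM]].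
exists (fun x y => enum_rank (L (enum_val x) (enum_val y))).
exists (fun x y => enum_rank (M (enum_val x) (enum_val y))).
exact: mols_transfer (@enum_valK T) (@enum_rankK T) LM.
Qed.

Lemma mols_prod (T U : Type) : has_mols T -> has_mols U -> has_mols (T * U).
Proof.
move=> [L [M [Li La Mi Ma LM]]] [L' [M' [Li' La' Mi' Ma' LM']]].
exists (fun x y => (L x.1 y.1, L' x.2 y.2)), (fun x y => (M x.1 y.1, M' x.2 y.2)).
split.
- by move=> i [a a'] [b b'] [/Li /= -> /Li' /= ->].
- by move=> a [i i'] [j j'] [/La /= -> /La' /= ->].
- by move=> i [a a'] [b b'] [/Mi /= -> /Mi' /= ->].
- by move=> a [i i'] [j j'] [/Ma /= -> /Ma' /= ->].
- move=> [i i'] [a a'] [j j'] [b b'] /= [e1 e1'] [e2 e2'].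
  by have [-> ->] := LM _ _ _ _ e1 e2; have [-> ->] := LM' _ _ _ _ e1' e2'.
Qed.

Lemma mols_mul m n : has_mols 'I_m -> has_mols 'I_n -> has_mols 'I_(m * n).
Proof.
by move=> mm mn; apply: (mols_card _ (mols_prod mm mn)); rewrite card_prod !card_ord.
Qed.

(** The linear construction: injectivity of A makes the second square Latin, and injectivity of A -
    1 makes the two orthogonal. *)
Lemma mols_additive (V : zmodType) (A : V -> V) : {morph A : x y / x - y} ->
  (forall x, A x = 0 -> x = 0) -> (forall x, A x = x -> x = 0) ->
  is_mols (fun x y => x + y) (fun x y => x + A y).
Proof.
move=> AB A0 A1.
have AI : injective A.
  by move=> x y E; apply/eqP; rewrite -subr_eq0; apply/eqP/A0; rewrite AB E subrr.
split.
- by move=> i a b /addrI.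
- by move=> a i j /addIr.
- by move=> i a b /addrI/AI.
- by move=> a i j /addIr.
- move=> i a j b e1 e2.
  suff ab : a = b by split=> //; apply: (addIr a); rewrite e1 ab.
  have shift u v : i + u = j + v -> u - v = j - i.
    by move=> E; rewrite -[u](addKr i) E addrA addrK addrC.
  by apply/eqP; rewrite -subr_eq0; apply/eqP/A1; rewrite AB !shift.
Qed.

(** The matrix of A has characteristic polynomial X^2 - X - 1, so A and A - 1 have determinant -1
    and are invertible over any abelian group. Over Z/2 this is multiplication by a generator of the
    field with four elements. *)
Lemma mols_square (V : zmodType) : is_mols (fun x y : V * V => x + y)
  (fun x y : V * V => x + (y.2, y.1 + y.2)).
Proof.
apply: (mols_additive (A := fun y : V * V => (y.2, y.1 + y.2))).
- by move=> [a b] [c e] /=; congr (_, _); rewrite /= opprD addrACA.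
- by move=> [a b] [-> /=]; rewrite addr0 => ->.
- move=> [a b] [-> E]; suff -> : a = 0 by [].
  by apply: (addrI a); rewrite E addr0.
Qed.

(** The same with X^3 - X - 1, which over Z/2 gives the field with eight elements. *)
Lemma mols_cube (V : zmodType) : has_mols (V * V * V).
Proof.
exists (fun x y => x + y), (fun x y => x + (y.2, y.1.1 + y.2, y.1.2)).
apply: (mols_additive (A := fun y : V * V * V => (y.2, y.1.1 + y.2, y.1.2))).
- by move=> [[a b] c] [[e f] g] /=; congr (_, _, _); rewrite /= opprD addrACA.
- by move=> [[a b] c] /= [-> /eqP]; rewrite addr0 => /eqP-> ->.
- move=> [[a b] c] /= [-> + ba]; rewrite ba => E; suff -> : a = 0 by [].
  by apply: (addrI a); rewrite E addr0.
Qed.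

Lemma mols_odd n : odd n -> has_mols 'I_n.
Proof.
case: n => // n n_odd; exists (fun x y => x + y), (fun x y => x + - y).
have dbl (x : 'I_n.+1) : x + x = 0 -> x = 0.
  move/(congr1 val) => /= /eqP; rewrite addnn -muln2.
  rewrite -/(dvdn _ _) Gauss_dvdl ?coprimen2 // => /dvdnP[k xk].
  apply: val_inj => /=; case: k xk => [//|k] xk.
  by have := ltn_ord x; rewrite xk mulSn -ltn_subRL subnn.
apply: mols_additive.
- by move=> x y; rewrite opprB opprK addrC.
- by move=> x /eqP; rewrite oppr_eq0 => /eqP.
- by move=> x E; apply: dbl; rewrite -{1}E addNr.
Qed.

Lemma mols4 : has_mols 'I_4.
Proof.
apply: (@mols_card ('I_2 * 'I_2)%type); first by rewrite card_prod card_ord.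
by exists (fun x y => x + y), (fun x y => x + (y.2, y.1 + y.2)); apply: mols_square.
Qed.

Lemma mols8 : has_mols 'I_8.
Proof.
apply: (@mols_card ('I_2 * 'I_2 * 'I_2)%type); first by rewrite !card_prod card_ord.
exact: mols_cube.
Qed.

(* A transversal design: a set of quadruples, given as functions on 'I_4, in
   which prescribing any two entries leaves exactly one quadruple.  Uniqueness
   is only required for the first two positions; together with existence it
   implies the other cases by counting. *)
Record is_td (T : Type) (B : ('I_4 -> T) -> Prop) : Prop := IsTD {
  td_ex : forall h h' v w, h != h' -> exists f, [/\ B f, f h = v & f h' = w];
  td_uniq : forall f g, B f -> B g -> f (o 0) = g (o 0) -> f (o 1) = g (o 1) -> f =1 g
}.

Lemma surj_inj (T : finType) (f : T -> T) : (forall y, exists x, f x = y) -> injective f.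
Proof.
move=> /fin_all_exists[g gK]; have g_inj : injective g by apply: can_inj gK.
by move=> x y; rewrite -(f_invF g_inj x) -(f_invF g_inj y) !gK => ->.
Qed.

(** Existence of blocks makes all the relevant maps surjective, hence injective by finiteness. *)
Lemma td_mols (T : finType) (B : ('I_4 -> T) -> Prop) : is_td B -> has_mols T.
Proof.
case=> ex un.
have /fin_all_exists[F FP] (p : T * T) :
    exists f, [/\ B f, f (o 0) = p.1 & f (o 1) = p.2] by exact: ex.
pose L i a := F (i, a) (o 2); pose M i a := F (i, a) (o 3).
have LM f : B f -> f =1 F (f (o 0), f (o 1)).
  by move=> Bf; have [BF F0 F1] := FP (f (o 0), f (o 1)); apply: un.
exists L, M; split.
- move=> i; apply: surj_inj => y; have [f [Bf f0 f2]] := ex (o 0) (o 2) i y isT.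
  by exists (f (o 1)); rewrite /L -f0 -LM.
- move=> a; apply: surj_inj => y; have [f [Bf f0 f2]] := ex (o 1) (o 2) a y isT.
  by exists (f (o 0)); rewrite /L -f0 -LM.
- move=> i; apply: surj_inj => y; have [f [Bf f0 f2]] := ex (o 0) (o 3) i y isT.
  by exists (f (o 1)); rewrite /M -f0 -LM.
- move=> a; apply: surj_inj => y; have [f [Bf f0 f2]] := ex (o 1) (o 3) a y isT.
  by exists (f (o 0)); rewrite /M -f0 -LM.
move=> i a j b e1 e2.
have /(_ (i, a) (j, b)) : injective (fun p : T * T => (L p.1 p.2, M p.1 p.2)).
  apply: surj_inj => -[y z]; have [f [Bf f0 f2]] := ex (o 2) (o 3) y z isT.
  by exists (f (o 0), f (o 1)); rewrite /L /M /= -!LM // f0 f2.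
by rewrite /= e1 e2 => /(_ erefl)[-> ->].
Qed.

Definition quad (T : Type) (x0 x1 x2 x3 : T) (h : 'I_4) : T := nth x0 [:: x0; x1; x2; x3] h.

Definition mols_td (T : Type) (L M : T -> T -> T) (f : 'I_4 -> T) : Prop :=
  f (o 2) = L (f (o 0)) (f (o 1)) /\ f (o 3) = M (f (o 0)) (f (o 1)).

Lemma mols_tdP (T : finType) (L M : T -> T -> T) : is_mols L M -> is_td (mols_td L M).
Proof.
case=> Li La Mi Ma LM; split; last first.
  by move=> f g [f2 f3] [g2 g3] e0 e1; apply: forall4; rewrite ?f2 ?f3 ?g2 ?g3 ?e0 ?e1.
have blk i a : mols_td L M (quad i a (L i a) (M i a)) by [].
have LMI : injective (fun p : T * T => (L p.1 p.2, M p.1 p.2)).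
  by move=> [i a] [j b] /= [e1 e2]; have [-> ->] := LM _ _ _ _ e1 e2.
suff lt_ex (h h' : 'I_4) v w : (h < h')%N ->
    exists f, [/\ mols_td L M f, f h = v & f h' = w].
  move=> h h' v w; rewrite neq_ltn => /orP[lt_h|lt_h]; first exact: lt_ex.
  by have [f [? ? ?]] := lt_ex _ _ w v lt_h; exists f.
move: h h'; apply: forall4; apply: forall4 => // _.
- by exists (quad v w (L v w) (M v w)).
- by exists (quad v (invF (Li v) w) (L v (invF (Li v) w)) (M v (invF (Li v) w)));
    split=> //; apply: f_invF.
- by exists (quad v (invF (Mi v) w) (L v (invF (Mi v) w)) (M v (invF (Mi v) w)));
    split=> //; apply: f_invF.
- by exists (quad (invF (La v) w) v (L (invF (La v) w) v) (M (invF (La v) w) v));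
    split=> //; apply: (f_invF (La v)).
- by exists (quad (invF (Ma v) w) v (L (invF (Ma v) w) v) (M (invF (Ma v) w) v));
    split=> //; apply: (f_invF (Ma v)).
- have := f_invF LMI (v, w); set p := invF LMI (v, w) => -[Lp Mp].
  by exists (quad p.1 p.2 (L p.1 p.2) (M p.1 p.2)).
Qed.

(** The design of the field with four elements, its zero renamed [None]; the zero block becomes the
    block at infinity. *)
Lemma td_option3 : exists B : ('I_4 -> option 'I_3) -> Prop,
  is_td B /\ B (fun=> None).
Proof.
pose z : 'I_2 := 0; pose u : 'I_2 := 1.
pose f (x : option 'I_3) : 'I_2 * 'I_2 :=
  if x is Some k then nth (z, u) [:: (z, u); (u, z); (u, u)] k else (z, z).
pose g (y : 'I_2 * 'I_2) : option 'I_3 :=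
  nth None [:: None; Some 0; Some 1; Some (1 + 1)] (y.1 + y.1 + y.2)%N.
have fK : cancel f g.
  by case=> [[[|[|[|//]]] lt_k]|] //; congr Some; apply: val_inj.
have gK : cancel g f.
  by case=> -[[|[|//]] lt_i] -[[|[|//]] lt_j]; congr (_, _); apply: val_inj.
pose A := mols_transfer fK gK (mols_square 'I_2).
by exists (mols_td (fun x y => g (f x + f y))
  (fun x y => g (f x + ((f y).2, (f y).1 + (f y).2)))); split; first exact: mols_tdP.
Qed.

(* Wilson's construction: in the transversal design of the points (h, p + q *+ h),
   h < 5, over V, the group h = 4 is truncated to W; a block becomes a design on
   three points per leg if its last point is lost, and otherwise a design on
   these points and one point of W, without the block at infinity. *)
Section Wilson.
Variables (V : finZmodType) (W : {pred V}).
Hypothesis muln_bij : forall k w, (0 < k < 5)%N -> exists q : V, q *+ k = w.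
Variables (B3 : ('I_4 -> 'I_3) -> Prop) (B4 : ('I_4 -> option 'I_3) -> Prop)
  (BW : ('I_4 -> {v | v \in W}) -> Prop).
Hypotheses (td3 : is_td B3) (td4 : is_td B4) (tdW : is_td BW).
Hypothesis B4None : B4 (fun=> None).

Local Notation X := ((V * 'I_3) + {v | v \in W})%type.

Variant wilson (f : 'I_4 -> X) : Prop :=
| Wilson3 p q g of B3 g & p + q *+ 4 \notin W & forall h, f h = inl (p + q *+ h, g h)
| Wilson4 p q (k : {v | v \in W}) g of B4 g & p + q *+ 4 = val k &
    (exists h, g h != None) &
    forall h, f h = if g h is Some m then inl (p + q *+ h, m) else inr k
| WilsonW g of BW g & forall h, f h = inr (g h).

(** The slope is found by dividing w - v by h' - h, which up to sign lies between 1 and 4. *)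
Lemma line_ex (h h' : nat) (v w : V) : (h < 5)%N -> (h' < 5)%N -> h != h' ->
  exists p q, p + q *+ h = v /\ p + q *+ h' = w.
Proof.
move=> h5 h5'; wlog lt_h : h h' v w h5 h5' / (h < h')%N.
  move=> th; rewrite neq_ltn => /orP[lt_h|lt_h].
    by apply: th; rewrite ?neq_ltn ?lt_h.
  have [|p [q [e1 e2]]] := th h' h w v h5' h5 lt_h; [by rewrite ltn_eqF | by exists p, q].
move=> _; have [|q qE] := @muln_bij (h' - h) (w - v).
  by rewrite subn_gt0 lt_h (leq_ltn_trans (leq_subr _ _)).
exists (v - q *+ h), q; split; first by rewrite subrK.
by rewrite -{1}(subnKC (ltnW lt_h)) mulrnDr addrA subrK qE addrC subrK.
Qed.

Lemma muln_inj k : (0 < k < 5)%N -> injective (fun q : V => q *+ k).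
Proof. by move=> k5; apply: surj_inj => w; apply: muln_bij. Qed.

Lemma wilson_td : is_td wilson.
Proof.
split.
- move=> h h' v w nhh.
  have h5 (i : 'I_4) : (i < 5)%N by apply: ltnW (ltn_ord i).
  have inlinr hh hh' x m k : hh != hh' ->
      exists f, [/\ wilson f, f hh = inl (x, m) & f hh' = inr k].
    move=> neq; have n4 : (hh : nat) != 4 by rewrite ltn_eqF.
    have [p [q [e1 e2]]] := line_ex x (val k) (h5 hh) (ltnSn 4) n4.
    have [g [Bg g1 g2]] := td_ex td4 (Some m) None neq.
    exists (fun i : 'I_4 => if g i is Some m then inl (p + q *+ i, m) else inr k).
    split; rewrite ?g1 ?g2 ?e1 //.
    by apply: Wilson4 Bg e2 _ _ => //; exists hh; rewrite g1.
  case: v w => [[x m]|k] [[y m']|k'].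
  + have [p [q [e1 e2]]] := line_ex x y (h5 h) (h5 h') nhh.
    case: (boolP (p + q *+ 4 \in W)) => inW.
      have [g [Bg g1 g2]] := td_ex td4 (Some m) (Some m') nhh.
      pose k : {v | v \in W} := Sub (p + q *+ 4) inW.
      exists (fun i : 'I_4 => if g i is Some m then inl (p + q *+ i, m) else inr k).
      split; rewrite ?g1 ?g2 ?e1 ?e2 //.
      by apply: (@Wilson4 _ p q k g) => //; exists h; rewrite g1.
    have [g [Bg g1 g2]] := td_ex td3 m m' nhh.
    exists (fun i : 'I_4 => inl (p + q *+ i, g i)); split; rewrite ?g1 ?g2 ?e1 ?e2 //.
    exact: Wilson3 Bg inW _.
  + exact: inlinr.
  + rewrite eq_sym in nhh; have [f [? ? ?]] := inlinr _ _ y m' k nhh.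
    by exists f.
  + have [g [Bg g1 g2]] := td_ex tdW k k' nhh.
    by exists (fun i => inr (g i)); split; rewrite ?g1 ?g2 //; apply: WilsonW Bg _.
- move=> f f' Bf Bf'.
  have line0 (p q p' q' : V) : p + q *+ 0 = p' + q' *+ 0 -> p = p'.
    by rewrite !mulr0n !addr0.
  have lines (p q p' q' : V) :
      p + q *+ 0 = p' + q' *+ 0 -> p + q *+ 1 = p' + q' *+ 1 -> p = p' /\ q = q'.
    by move=> /line0 ->; rewrite !mulr1n => /addrI.
  (* A block with [None] on legs 0 and 1 would be the block at infinity, which is left out of
     [Wilson4]. *)
  have noNone g : B4 g -> (exists h, g h != None) -> g (o 0) = None -> g (o 1) = None -> False.
    by move=> Bg [h gh] g0 g1; move: gh; rewrite (td_uniq td4 Bg B4None g0 g1).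
  case: Bf Bf' => [p q g Bg nW fE|p q k g Bg pk gN fE|g Bg fE]
    [p' q' g' Bg' nW' fE'|p' q' k' g' Bg' pk' gN' fE'|g' Bg' fE'] e0 e1 h;
    rewrite fE fE'; move: e0 e1; rewrite !fE !fE'.
  + move=> [e0 g0] [e1 g1]; have [-> ->] := lines _ _ _ _ e0 e1.
    by rewrite (td_uniq td3 Bg Bg' g0 g1).
  + case g0: (g' (o 0)) => [m|//] [e0 _]; case g1: (g' (o 1)) => [m'|//] [e1 _].
    by have [ep eq] := lines _ _ _ _ e0 e1; move: nW; rewrite ep eq pk' (valP k').
  + by [].
  + case g0: (g (o 0)) => [m|//] [e0 _]; case g1: (g (o 1)) => [m'|//] [e1 _].
    by have [ep eq] := lines _ _ _ _ e0 e1; move: nW'; rewrite -ep -eq pk (valP k).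
  + have gg : g (o 0) = g' (o 0) -> g (o 1) = g' (o 1) -> p = p' -> q = q' -> k = k' ->
        (if g h is Some m then inl (p + q *+ h, m) else inr k) =
        (if g' h is Some m then inl (p' + q' *+ h, m) else inr k') :> X.
      by move=> e0 e1 -> -> ->; rewrite (td_uniq td4 Bg Bg' e0 e1).
    (* A finite entry on leg 0 or 1 fixes the line there, and an infinite one fixes it at h = 4. The
       slope follows from two of the positions 0, 1 and 4, by cancelling 1, 4 or 3. *)
    case g0: (g (o 0)) => [m|]; case g0': (g' (o 0)) => [m'|] //.
      move=> [e0 em]; case g1: (g (o 1)) => [n|]; case g1': (g' (o 1)) => [n'|] //.
        move=> [e1 en]; have [ep eq] := lines _ _ _ _ e0 e1; apply: gg => //.
        - by rewrite g0 g0' em.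
        - by rewrite g1 g1' en.
        - by apply: val_inj; rewrite -pk -pk' ep eq.
      move=> [ek]; have ep := line0 _ _ _ _ e0.
      apply: gg => //; rewrite ?g0 ?g0' ?g1 ?g1' ?em //.
      by apply: (@muln_inj 4) => //; apply: (addrI p); rewrite pk ek -pk' ep.
    move=> [ek]; case g1: (g (o 1)) => [n|]; case g1': (g' (o 1)) => [n'|] //.
      move=> [e1 en].
      have eq : q = q'.
        apply: (@muln_inj 3) => //; apply: (addrI (p + q *+ 1)).
        by rewrite -addrA -mulrnDr pk ek -pk' e1 -addrA -mulrnDr.
      apply: gg => //; rewrite ?g0 ?g0' ?g1 ?g1' ?en //.
      by move: e1; rewrite eq => /addIr.
    by have := noNone _ Bg gN g0 g1.
  + case g0: (g (o 0)) => [//|] _; case g1: (g (o 1)) => [//|] _.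
    by have := noNone _ Bg gN g0 g1.
  + by [].
  + case g0: (g' (o 0)) => [//|] _; case g1: (g' (o 1)) => [//|] _.
    by have := noNone _ Bg' gN' g0 g1.
  + by move=> [e0] [e1]; rewrite (td_uniq tdW Bg Bg' e0 e1).
Qed.

End Wilson.

(** * Orders 10 and 14 by computation, then all orders other than 2 and 6 *)

Section Tables.
Local Open Scope nat_scope.

Definition td_table (n : nat) (Q : seq (seq nat)) : bool :=
  [&& all (fun q => (size q == 4) && all (fun x => x < n) q) Q,
      all (fun h => all (fun h' => (h != h') ==>
        all (fun v => all (fun w =>
          has (fun q => (nth 0 q h == v) && (nth 0 q h' == w)) Q)
        (iota 0 n)) (iota 0 n)) (iota 0 4)) (iota 0 4) &
      all (fun q => all (fun q' =>
        (nth 0 q 0 == nth 0 q' 0) && (nth 0 q 1 == nth 0 q' 1) ==> (q == q')) Q) Q].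

Lemma td_table_mols n Q : td_table n Q -> has_mols 'I_n.
Proof.
case/and3P=> /allP Qn /allP Qex /allP Qun.
pose B (f : 'I_4 -> 'I_n) := [seq f h : nat | h <- enum 'I_4] \in Q.
have nthB (f : 'I_4 -> 'I_n) (h : 'I_4) : nth 0 [seq f h : nat | h <- enum 'I_4] h = f h.
  by rewrite (nth_map h) ?size_enum_ord // nth_ord_enum.
apply: (@td_mols _ B).
have I_iota k (i : 'I_k) : (i : nat) \in iota 0 k by rewrite mem_iota /= ltn_ord.
split=> [h h' v w nhh|f g Bf Bg e0 e1 h].
  have /implyP/(_ nhh)/allP/(_ v (I_iota _ v)) := allP (Qex _ (I_iota _ h)) _ (I_iota _ h').
  move=> /allP/(_ w (I_iota _ w))/hasP[q qQ /andP[/eqP qv /eqP qw]].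
  have /andP[/eqP q4 /allP qn] := Qn _ qQ.
  have qlt (k : 'I_4) : nth 0 q k < n by apply/qn/mem_nth; rewrite q4.
  exists (fun k => Ordinal (qlt k)); split; last 2 first.
  - exact: val_inj.
  - exact: val_inj.
  rewrite /B (_ : [seq _ | _ <- _] = q) //; apply: (@eq_from_nth _ 0).
    by rewrite size_map size_enum_ord q4.
  move=> k; rewrite size_map size_enum_ord => k4.
  by rewrite -[k]/(nat_of_ord (Ordinal k4)) nthB.
have := allP (Qun _ Bf) _ Bg.
rewrite -[X in nth 0 _ X == _]/(nat_of_ord (o 0)) !(nthB _ (o 0)) !(nthB _ (o 1)).
by rewrite e0 e1 !eqxx /= => /eqP E; apply: val_inj; rewrite /= -!nthB E.
Qed.

(* The blocks obtained from quasi-difference columns over Z/N with three points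
   at infinity N, N+1, N+2: every column is developed by translation and by
   cyclic rotation of its entries.  In [infs] the missing fourth entry is the
   k-th infinite point. *)
Definition develop (N : nat) (full infs : seq (seq nat)) : seq (seq nat) :=
  [seq nseq 4 g | g <- iota 0 N] ++
  flatten [seq [seq rot r [seq (x + g) %% N | x <- c] | r <- iota 0 4, g <- iota 0 N]
    | c <- full] ++
  flatten [seq [seq rot r (N + k :: [seq (x + g) %% N | x <- nth [::] infs k])
    | r <- iota 0 4, g <- iota 0 N] | k <- iota 0 3] ++
  [seq [:: N + i; N + j; N + (i + j) %% 3; N + (i + 2 * j) %% 3]
    | i <- iota 0 3, j <- iota 0 3].

Lemma mols10 : has_mols 'I_10.
Proof.
apply: (@td_table_mols _ (develop 7 [::] [:: [:: 0; 1; 4]; [:: 0; 2; 1]; [:: 0; 4; 2]])).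
by vm_compute.
Qed.

Lemma mols14 : has_mols 'I_14.
Proof.
apply: (@td_table_mols _ (develop 11 [:: [:: 0; 1; 4; 6]]
  [:: [:: 0; 4; 1]; [:: 0; 6; 2]; [:: 0; 9; 8]])).
by vm_compute.
Qed.

Lemma mols_card_inv (T : finType) n : #|T| = n -> has_mols 'I_n -> has_mols T.
Proof.
move=> <- [L [M LM]].
exists (fun x y => enum_val (L (enum_rank x) (enum_rank y))).
exists (fun x y => enum_val (M (enum_rank x) (enum_rank y))).
exact: mols_transfer (@enum_rankK T) (@enum_valK T) LM.
Qed.

(** By Euler's theorem the power of k with exponent [(totient s.+1).-1] inverts k modulo [s.+1]. *)
Lemma Zp_muln_surj s k (w : 'I_s.+1) : coprime s.+1 k ->
  exists q : 'I_s.+1, (q *+ k = w)%R.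
Proof.
move=> sk; exists (w *+ (k ^ (totient s.+1).-1))%R.
rewrite -mulrnA -expnSr prednK ?totient_gt0 //.
apply: val_inj; rewrite Zp_mulrn /= -modnMmr Euler_exp_totient 1?coprime_sym //.
by rewrite modnMmr muln1 modn_small.
Qed.

(** Wilson's construction over Z/s, with the first u residues as truncated group; coprimality with 6
    makes 1, 2, 3 and 4 invertible. *)
Lemma mols_wilson s u : coprime s 6 -> (u <= s)%N -> has_mols 'I_u ->
  has_mols 'I_(3 * s + u).
Proof.
case: s => // s s6 us mu.
have [B4 [td4 B4N]] := td_option3.
have [L3 [M3 LM3]] : has_mols 'I_3 by apply: mols_odd.
pose W : {pred 'I_s.+1} := [pred v : 'I_s.+1 | v < u].
have Wcard : #|{: {v | v \in W}}| = u.
  rewrite card_sig -sum1_card -[RHS]card_ord -sum1_card.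
  by rewrite (big_ord_widen _ (fun=> 1) us).
have mul_bij k (w : 'I_s.+1) : 0 < k < 5 -> exists q : 'I_s.+1, (q *+ k = w)%R.
  move=> k5; apply: Zp_muln_surj; move: s6; rewrite (coprimeMr _ 2 3) => /andP[s2 s3].
  case: k k5 => [|[|[|[|[|]]]]] //= _; first exact: coprimen1.
  by rewrite (coprimeMr _ 2 2) s2.
have [L' [M' LM']] := mols_card_inv Wcard mu.
have td := wilson_td mul_bij (mols_tdP LM3) td4 (mols_tdP LM') B4N.
apply: (@mols_card (('I_s.+1 * 'I_3) + {v | v \in W})%type); last exact: td_mols td.
by rewrite card_sum card_prod !card_ord Wcard mulnC.
Qed.

(** Apart from 10, 14 and 30, which are treated directly, d is written as 3 s + u with s = 12 k + c
    coprime to 6 and u odd, at most s. The choice of c and u depends on d modulo 36. *)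
Lemma mols_2mod4 d : d %% 4 = 2 -> d != 2 -> d != 6 -> has_mols 'I_d.
Proof.
move=> d4 d2 d6.
have cop k c : coprime c 6 -> coprime (12 * k + c) 6.
  by rewrite -[coprime (_ + _) _]coprime_modl -modnDml -modnMml mul0n mod0n
    add0n coprime_modl.
have wil k c u : coprime c 6 -> odd u -> u <= 12 * k + c ->
    d = 36 * k + (3 * c + u) -> has_mols 'I_d.
  move=> c6 u_odd us ->; rewrite (_ : _ + _ = 3 * (12 * k + c) + u); last by lia.
  by apply: mols_wilson; rewrite ?cop //; apply: mols_odd.
have dE := divn_eq d 36; move: (d %/ 36) dE => k dE.
have d36 : (d %% 36) %% 4 = 2 by rewrite modn_dvdm.
have : d %% 36 < 36 by rewrite ltn_mod.
move: (d %% 36) d36 dE => r r4 dE r36.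
have : r = 2 \/ r = 6 \/ r = 10 \/ r = 14 \/ r = 18 \/ r = 22 \/ r = 26 \/
    r = 30 \/ r = 34 by lia.
case: k dE => [|k] dE => -[|[|[|[|[|[|[|[|]]]]]]]] rE; subst r.
- by rewrite dE in d2.
- by rewrite dE in d6.
- by rewrite dE; apply: mols10.
- by rewrite dE; apply: mols14.
- by apply: (wil 0 5 3).
- by apply: (wil 0 7 1).
- by apply: (wil 0 7 5).
- by rewrite dE; apply: (@mols_mul 3 10); [apply: mols_odd | apply: mols10].
- by apply: (wil 0 11 1).
- by apply: (wil k 11 5) => //; lia.
- by apply: (wil k 13 3) => //; lia.
- by apply: (wil k 13 7) => //; lia.
- by apply: (wil k 13 11) => //; lia.
- by apply: (wil k.+1 5 3) => //; lia.
- by apply: (wil k.+1 7 1) => //; lia.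
- by apply: (wil k.+1 7 5) => //; lia.
- by apply: (wil k 19 9) => //; lia.
- by apply: (wil k.+1 11 1) => //; lia.
Qed.

(** Multiples of 4 are handled by products. A factor 8 is split off when d is an odd multiple of 8,
    because d / 4 could then be 2 or 6. *)
Lemma mols_exist d : 2 < d -> d != 6 -> has_mols 'I_d.
Proof.
have [m] := ubnP d; elim: m d => // m IHm d; rewrite ltnS => dm d2 d6.
have [d_odd|d_even] := boolP (odd d); first exact: mols_odd.
have : d %% 4 = 2 \/ d = 4 * (d %/ 4) by lia.
case=> [d4|dE]; first by apply: mols_2mod4 => //; lia.
have [e_odd|e_even] := boolP (odd (d %/ 4)).
  by rewrite dE; apply: mols_mul; [exact: mols4 | exact: mols_odd].
have eE : d = 8 * (d %/ 8) by lia.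
have [f_odd|f_even] := boolP (odd (d %/ 8)).
  by rewrite eE; apply: mols_mul; [exact: mols8 | exact: mols_odd].
(* Here 16 divides d, so d / 4 is a multiple of 4 and the induction hypothesis applies. *)
rewrite dE; apply: mols_mul; first exact: mols4.
by apply: IHm; lia.
Qed.
End Tables.

(* Infinitely many LU-classes of 2-unitaries of size d^2: for every n there are
   n pairwise LU-inequivalent 2-unitary matrices. *)
Theorem theorem2 (R : realType) (d : nat) : (4 <= d)%N ->
  forall n : nat, exists f : 'I_n -> 'M[R[i]]_(d * d),
    (forall k, two_unitary (f k)) /\
    (forall k l, k != l -> ~ LU_equiv (f k) (f l)).
Proof.
move=> d4; have [->|d6] := eqVneq d 6; first exact: six_classes.
by apply: mols_classes => //; apply: mols_exist => //; apply: ltnW.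
Qed.
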